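(* Let $\mathcal E$ be a class of superreflexive Banach spaces stable by ultraproducts, and let $G$ be a finitely generated discrete group. If $G$ has (F$_{\mathcal E}$), then $G$ has robust property (T) with respect to $\mathcal E$.
   Context: $G$ has (F$_{\mathcal E}$) if every affine isometric action of $G$ on a space in $\mathcal E$ has a fixed point. A Banach space $X$ is superreflexive if every Banach space finitely representable in $X$ is reflexive. Ultraproducts are Banach space ultraproducts: $\prod_{\mathcal U}E_i$ is the quotient of the space of bounded families $(x_i)\in\prod_iE_i$ by those with $\lim_{\mathcal U}\|x_i\|=0$. Let $S$ be a finite symmetric generating set of $G$ containing the identity and $\ell(g)=\min\{n:g\in S^n\}$. For $c>0$, $\mathcal F(\mathcal E,c\ell)$ is the collection of representations $(\pi,E)$ of $G$ (by bounded invertible operators) with $E$ isometric to a space in $\mathcal E$ and $\|\pi(g)\|_{B(E)}\le e^{c\ell(g)}$ for all $g\in G$. For a collection $\mathcal F$ of representations, $\mathcal C_{\mathcal F}(G)$ is the (Hausdorff) completion of the group algebra $\mathbf C[G]$ for $\|a\|_{\mathcal F}=\sup_{(\pi,E)\in\mathcal F}\|\pi(a)\|_{B(E)}$. A Kazhdan projection in $\mathcal C_{\mathcal F}(G)$ is an idempotent $p$ in the closure of $\{m\in\mathbf C[G]:\sum_gm(g)=1\}$ such that $\pi(p)$ is a projection onto $E^\pi=\{x:\pi(g)x=x\ \forall g\}$ for every $(\pi,E)\in\mathcal F$. $G$ has robust property (T) with respect to $\mathcal E$ if there exists $c>0$ such that $\mathcal C_{\mathcal F(\mathcal E,c\ell)}(G)$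 has a Kazhdan projection. *)

(* Defs.v *)
From HB Require Import structures.
From mathcomp Require Import all_boot all_order all_algebra.
From mathcomp Require Import complex.
From mathcomp Require Import finmap.
From mathcomp.multinomials Require Import monalg.
From mathcomp Require Import all_classical all_reals all_analysis.
From mathcomp Require Import ring lra.
Set Implicit Arguments. Unset Strict Implicit. Unset Printing Implicit Defensive.
Import Order.TTheory GRing.Theory Num.Theory numFieldNormedType.Exports.
Local Open Scope classical_set_scope.
Local Open Scope ring_scope.

(* Banach spaces are complex: the scalar field is R[i] for a realType R, and a
   Banach space is a completeNormedModType R[i].  The library norm of such a
   space takes its values in R[i]; rnorm is the same norm with values in R. *)
Definition rnorm (R : realType) (V : normedZmodType R[i]) (x : V) : R :=
  complex.Re `|x|.

Section RealNorm.
Variable R : realType.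
Local Notation C := R[i].

Lemma rnormE (V : normedZmodType C) (x : V) : `|x| = (rnorm x)%:C%C.
Proof. by rewrite RRe_real // normr_real. Qed.

Lemma rnorm_ge0 (V : normedZmodType C) (x : V) : 0 <= rnorm x.
Proof. by rewrite -lecR -rnormE normr_ge0. Qed.

Lemma rnormD (V : normedZmodType C) (x y : V) :
  rnorm (x + y) <= rnorm x + rnorm y.
Proof. by rewrite -lecR rmorphD /= -!rnormE ler_normD. Qed.

Lemma rnormN (V : normedZmodType C) (x : V) : rnorm (- x) = rnorm x.
Proof. by rewrite /rnorm normrN. Qed.

Lemma rnormC (V : normedZmodType C) (x y : V) : rnorm (x - y) = rnorm (y - x).
Proof. by rewrite -rnormN opprB. Qed.

Lemma rnormZ (V : normedModType C) (a : C) (x : V) :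
  rnorm (a *: x) = rnorm a * rnorm x.
Proof.
by apply: (fmorph_inj (real_complex R)); rewrite rmorphM /= -!rnormE normrZ.
Qed.

Lemma rnormM (a b : C) : rnorm (a * b) = rnorm a * rnorm b.
Proof.
by apply: (fmorph_inj (real_complex R)); rewrite rmorphM /= -!rnormE normrM.
Qed.

Lemma rnorm0 (V : normedZmodType C) : rnorm (0 : V) = 0.
Proof. by rewrite /rnorm normr0. Qed.

Lemma rnorm1 : rnorm (1 : C) = 1.
Proof. by rewrite /rnorm normr1. Qed.

Lemma rnormR (r : R) : rnorm (r%:C%C) = `|r|.
Proof. by rewrite /rnorm normc_def /= expr0n addr0 sqrtr_sqr. Qed.

Lemma rnorm0_eq0 (V : normedZmodType C) (x : V) : rnorm x = 0 -> x = 0.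
Proof. by move=> x0; apply/eqP; rewrite -normr_eq0 rnormE x0. Qed.

End RealNorm.

Record seminorm (R : realType) (V : lmodType R[i]) := Seminorm {
  sn_fun :> V -> R;
  snD : forall x y, sn_fun (x + y) <= sn_fun x + sn_fun y;
  snZ : forall (a : R[i]) x, sn_fun (a *: x) = rnorm a * sn_fun x }.

Section SeminormTheory.
Variables (R : realType) (V : lmodType R[i]) (p : seminorm V).
Implicit Types (u : nat -> V) (l : V).

Definition sn_cauchy u := forall e, 0 < e ->
  exists N, forall m n, (N <= m)%N -> (N <= n)%N -> p (u m - u n) <= e.

Definition sn_cvg u l := forall e, 0 < e ->
  exists N, forall n, (N <= n)%N -> p (u n - l) <= e.

Definition sn_complete := forall u, sn_cauchy u -> exists l, sn_cvg u l.

Lemma sn0 : p 0 = 0.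
Proof. by rewrite -(scale0r (0 : V)) snZ rnorm0 mul0r. Qed.

Lemma snN x : p (- x) = p x.
Proof. by rewrite -scaleN1r snZ rnormN rnorm1 mul1r. Qed.

Lemma sn_ge0 x : 0 <= p x.
Proof.
have := snD p x (- x); rewrite subrr sn0 snN => h.
lra.
Qed.

Lemma snC x y : p (x - y) = p (y - x).
Proof. by rewrite -snN opprB. Qed.

Lemma sn_tri y x z : p (x - z) <= p (x - y) + p (y - z).
Proof. by have := snD p (x - y) (y - z); rewrite addrA subrK. Qed.

Lemma sn_lip x y : `|p x - p y| <= p (x - y).
Proof.
have h1 := snD p (x - y) y; have h2 := snD p (y - x) x.
rewrite !subrK in h1 h2; rewrite (snC y x) in h2.
by rewrite ler_norml; apply/andP; split; lra.
Qed.

Lemma half_gt0 n : 0 < (2^-1 : R) ^+ n.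
Proof. by rewrite exprn_gt0 // invr_gt0. Qed.

Lemma half_small (e : R) : 0 < e -> exists N, forall n, (N <= n)%N ->
  (2^-1 : R) ^+ n <= e.
Proof.
move=> e0; have /cvgrPdist_le /(_ e e0) [N _ hN] :
    (fun n => (2^-1 : R) ^+ n) @ \oo --> (0 : R).
  by apply: cvg_expr; rewrite ger0_norm ?invr_ge0 // invf_lt1 // ltr1n.
by exists N => n /hN /=; rewrite sub0r normrN ger0_norm // ltW // half_gt0.
Qed.

Lemma fast_dist u (hu : forall n, p (u n.+1 - u n) <= 2^-1 ^+ n) n k :
  p (u (n + k)%N - u n) <= 2 * 2^-1 ^+ n.
Proof.
suff : p (u (n + k)%N - u n) <= 2 * 2^-1 ^+ n - 2 * 2^-1 ^+ (n + k).
  move=> h; have := half_gt0 (n + k); lra.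
elim: k => [|k IH]; first by rewrite addn0 !subrr sn0.
rewrite addnS; have h1 := sn_tri (u (n + k)%N) (u (n + k).+1) (u n).
have h2 := hu (n + k)%N; rewrite exprS mulrA mulfV ?pnatr_eq0 // mul1r.
lra.
Qed.

Lemma fast_cauchy u (hu : forall n, p (u n.+1 - u n) <= 2^-1 ^+ n) :
  sn_cauchy u.
Proof.
move=> e e0; have e40 : 0 < e / 4 by apply: divr_gt0.
have [N hN] := half_small e40; exists N => m n Nm Nn.
have a1 := sn_tri (u N) (u m) (u n); have a0 := hN _ (leqnn N).
have a2 := fast_dist hu N (m - N); have a3 := fast_dist hu N (n - N).
rewrite subnKC // in a2; rewrite subnKC // (snC (u n)) in a3; lra.
Qed.

Lemma fast_lim u l (hu : forall n, p (u n.+1 - u n) <= 2^-1 ^+ n) :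
  sn_cvg u l -> forall n, p (u n - l) <= 2 * 2^-1 ^+ n.
Proof.
move=> ul n; apply/ler_addgt0Pr => e /ul [N /(_ (n + N)%N (leq_addl _ _))].
have := sn_tri (u (n + N)%N) (u n) l; have := fast_dist hu n N.
rewrite (snC (u n) (u _)); lra.
Qed.

Lemma fast_complete :
  (forall u, (forall n, p (u n.+1 - u n) <= 2^-1 ^+ n) ->
     exists l, sn_cvg u l) -> sn_complete.
Proof.
move=> H u cu.
have /choice [f hf] k := cu _ (half_gt0 k).
pose g k := (\max_(j < k.+1) f j)%N.
have fg k : (f k <= g k)%N by apply: (@leq_bigmax _ (fun j : 'I_k.+1 => f j) ord_max).
have fg' k : (f k <= g k.+1)%N.
  by rewrite /g big_ord_recr /= leq_max [X in X || _](_ : _ = true) // fg.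
have [l hl] : exists l, sn_cvg (u \o g) l.
  by apply: H => k /=; apply: hf.
exists l => e e0; have e20 : 0 < e / 2 by apply: divr_gt0.
have [K1 h1] := half_small e20; have [K2 h2] := hl _ e20.
pose K := maxn K1 K2; exists (f K) => n fn.
have a1 := sn_tri (u (g K)) (u n) l.
have a2 := hf K n (g K) fn (fg K).
have a3 := h1 K (leq_maxl _ _); have a4 := h2 K (leq_maxr _ _).
rewrite /= in a4; lra.
Qed.

End SeminormTheory.

Definition rnorm_seminorm (R : realType) (V : normedModType R[i]) :=
  Seminorm (@rnormD R V) (@rnormZ R V).

Section Completeness.
Variables (R : realType) (V : normedModType R[i]).
Local Notation p := (rnorm_seminorm V).

Lemma ball_rnorm (x y : V) (e : R) : ball x e%:C%C y <-> rnorm (x - y) < e.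
Proof. by rewrite -ball_normE /= rnormE ltcR. Qed.

Lemma sn_cvgP (u : nat -> V) (l : V) : sn_cvg p u l <-> u @ \oo --> l.
Proof.
split=> [h|/cvgrPdist_le h e e0].
  apply/cvgrPdist_le => e e0.
  have eR : e = (complex.Re e)%:C%C by rewrite RRe_real // gtr0_real.
  have e0' : 0 < complex.Re e by rewrite -ltcR -eR.
  have [N hN] := h _ e0'; exists N => // n /= /hN /= h'.
  by rewrite rnormE eR lecR rnormC.
have [|N _ hN] := h (e%:C%C); first by rewrite ltcR.
by exists N => n /hN /=; rewrite rnormE lecR rnormC.
Qed.

Lemma sn_complete_cvg : sn_complete p ->
  forall F : set_system V, ProperFilter F -> cauchy F -> cvg F.
Proof.
move=> H F PF /cauchyP cF.
have /choice [x hx] n : exists x : V, F (ball x ((2^-1 : R) ^+ n)%:C%C).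
  by apply: cF; rewrite ltcR half_gt0.
have dx m n : p (x m - x n) <= 2^-1 ^+ m + 2^-1 ^+ n.
  have [z [/ball_rnorm zm /ball_rnorm zn]] := filter_ex (filterI (hx m) (hx n)).
  have := sn_tri p z (x m) (x n); rewrite /= (rnormC z) => h.
  by apply: le_trans h _; apply: lerD; apply: ltW.
have [l hl] : exists l, sn_cvg p x l.
  apply: H => e e0; have e20 : 0 < e / 2 by apply: divr_gt0.
  have [N hN] := half_small e20; exists N => m n /hN h1 /hN h2.
  have := dx m n; lra.
apply/cvg_ex; exists l; apply/cvgrPdist_lt => e e0.
have eR : e = (complex.Re e)%:C%C by rewrite RRe_real // gtr0_real.
have e0' : 0 < complex.Re e by rewrite -ltcR -eR.
rewrite eR; move: (complex.Re e) e0' => {e0 eR} e e0.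
have e20 : 0 < e / 2 by apply: divr_gt0.
have [N1 h1] := half_small e20; have [N2 h2] := hl _ e20.
pose N := maxn N1 N2.
apply: filterS (hx N) => z /ball_rnorm hz.
rewrite rnormE ltcR; have := sn_tri p (x N) l z.
have := h1 N (leq_maxl _ _); have := h2 N (leq_maxr _ _).
rewrite /= (rnormC (x N) l) => a b c; lra.
Qed.

End Completeness.

Lemma banach_complete (R : realType) (V : completeNormedModType R[i]) :
  sn_complete (rnorm_seminorm V).
Proof.
move=> u cu; have /cauchy_cvg : cauchy (u @ \oo).
  apply/cauchyP => e e0.
  have eR : e = (complex.Re e)%:C%C by rewrite RRe_real // gtr0_real.
  have e0' : 0 < complex.Re e by rewrite -ltcR -eR.
  have e20 : 0 < complex.Re e / 2 by apply: divr_gt0.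
  have [N hN] := cu _ e20; exists (u N); exists N => // n /= Nn.
  rewrite /= eR; apply/ball_rnorm; apply: le_lt_trans (hN N n _ _) _ => //.
  by rewrite ltr_pdivrMr // mulr2n mulrDr mulr1 ltrDl.
by move=> /cvg_ex [l hl]; exists l; apply/sn_cvgP.
Qed.

Record complete_seminorm (R : realType) (V : lmodType R[i]) :=
  CompleteSeminorm { csn :> seminorm V; csnP : sn_complete csn }.

Definition sn_ker (R : realType) (V : lmodType R[i])
  (N : complete_seminorm V) : {pred V} := [pred x | N x == 0].

Section SnKer.
Variables (R : realType) (V : lmodType R[i]) (N : complete_seminorm V).

Fact sn_ker_zmod_closed : zmod_closed (sn_ker N).
Proof.
split=> [|x y /eqP x0 /eqP y0]; first by rewrite inE sn0.
by rewrite inE eq_le sn_ge0 andbT (le_trans (snD _ _ _)) // snN x0 y0 addr0.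
Qed.

HB.instance Definition _ :=
  GRing.isZmodClosed.Build V (sn_ker N) sn_ker_zmod_closed.

(* The Banach space V / {N = 0} attached to a complete seminorm N on V. *)
Definition sepquot : Type := Quotient.quot (sn_ker N).

HB.instance Definition _ := GRing.Zmodule.on sepquot.

Definition sepquot_pi (x : V) : sepquot := \pi_(Quotient.quot (sn_ker N))%qT x.
Definition sepquot_repr (x : sepquot) : V := repr (x : Quotient.quot (sn_ker N)).

Local Notation pi := sepquot_pi.
Local Notation rep := sepquot_repr.

Lemma sepquot_reprK x : pi (rep x) = x.
Proof. exact: reprK. Qed.

Lemma sepquot_eqP x y : pi x = pi y <-> N (x - y) = 0.
Proof.
rewrite /pi; split => [/eqP|h]; last apply/eqP; rewrite -Quotient.idealrBE inE.
  by move/eqP.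
exact/eqP.
Qed.

Lemma sepquot_reprP x : N (rep (pi x) - x) = 0.
Proof. by apply/sepquot_eqP; rewrite sepquot_reprK. Qed.

Lemma sepquot_piD x y : pi (x + y) = pi x + pi y.
Proof. exact: Quotient.pi_add. Qed.

Lemma sepquot_piN x : pi (- x) = - pi x.
Proof. exact: Quotient.pi_opp. Qed.

Lemma sepquot_piB x y : pi (x - y) = pi x - pi y.
Proof. by rewrite sepquot_piD sepquot_piN. Qed.

Definition sepquot_scale (a : R[i]) (x : sepquot) : sepquot := pi (a *: rep x).

Lemma sepquot_piZ a x : sepquot_scale a (pi x) = pi (a *: x).
Proof. by apply/sepquot_eqP; rewrite -scalerBr snZ sepquot_reprP mulr0. Qed.

Fact sepquot_scaleA a b x :
  sepquot_scale a (sepquot_scale b x) = sepquot_scale (a * b) x.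
Proof. by rewrite -(sepquot_reprK x) !sepquot_piZ scalerA. Qed.

Fact sepquot_scale1 : left_id 1 sepquot_scale.
Proof. by move=> x; rewrite -(sepquot_reprK x) sepquot_piZ scale1r. Qed.

Fact sepquot_scaleDr : right_distributive sepquot_scale +%R.
Proof.
move=> a x y; rewrite -(sepquot_reprK x) -(sepquot_reprK y).
by rewrite -sepquot_piD !sepquot_piZ scalerDr sepquot_piD.
Qed.

Fact sepquot_scaleDl x : {morph sepquot_scale^~ x : a b / a + b}.
Proof.
move=> a b; rewrite -(sepquot_reprK x).
by rewrite !sepquot_piZ scalerDl sepquot_piD.
Qed.

HB.instance Definition _ := GRing.Zmodule_isLmodule.Build R[i] sepquot
  sepquot_scaleA sepquot_scale1 sepquot_scaleDr sepquot_scaleDl.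

Definition sepquot_norm (x : sepquot) : R[i] := (N (rep x))%:C%C.

Lemma sepquot_normE x : sepquot_norm (pi x) = (N x)%:C%C.
Proof.
congr (_ %:C)%C; apply/eqP; rewrite -subr_eq0 -normr_le0.
by rewrite (le_trans (sn_lip _ _ _)) // sepquot_reprP.
Qed.

Fact sepquot_normD x y :
  sepquot_norm (x + y) <= sepquot_norm x + sepquot_norm y.
Proof.
rewrite -(sepquot_reprK x) -(sepquot_reprK y) -sepquot_piD !sepquot_normE.
by rewrite -rmorphD lecR snD.
Qed.

Fact sepquot_normZ (a : R[i]) x :
  sepquot_norm (a *: x) = `|a| * sepquot_norm x.
Proof.
rewrite -(sepquot_reprK x) [a *: _]sepquot_piZ !sepquot_normE snZ.
by rewrite rmorphM /= -rnormE.
Qed.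

Fact sepquot_norm0 x : sepquot_norm x = 0 -> x = 0.
Proof.
rewrite -(sepquot_reprK x) sepquot_normE => -[h].
have -> : 0 = pi 0 :> sepquot by rewrite -(subrr (0 : V)) sepquot_piB subrr.
by apply/sepquot_eqP; rewrite subr0.
Qed.

HB.instance Definition _ := Lmodule_isNormed.Build R[i] sepquot
  sepquot_normD sepquot_normZ sepquot_norm0.

Lemma sepquot_rnormE (x : V) : rnorm (pi x : sepquot) = N x.
Proof. by rewrite /rnorm [X in complex.Re X]sepquot_normE. Qed.

Fact sepquot_sn_complete : sn_complete (rnorm_seminorm sepquot).
Proof.
move=> u cu.
have [|l hl] := @csnP _ _ N (rep \o u).
  move=> e /cu [K hK]; exists K => m n Km Kn; have := hK m n Km Kn.
  by rewrite /= -sepquot_rnormE sepquot_piB !sepquot_reprK.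
exists (pi l) => e /hl [K hK]; exists K => n /hK.
by rewrite /= -sepquot_rnormE sepquot_piB !sepquot_reprK.
Qed.

HB.instance Definition _ := Uniform_isComplete.Build sepquot
  (sn_complete_cvg sepquot_sn_complete).

End SnKer.

Section BoundedOp.
Variables (R : realType) (X Y : normedModType R[i]).

Definition bounded_op : {pred X -> Y} :=
  mem [set f : X -> Y | linear f /\
                        exists M, forall x, rnorm (f x) <= M * rnorm x].

Record boundedOp : Type :=
  BoundedOp { bop_fun :> X -> Y; bopP : bop_fun \in bounded_op }.

HB.instance Definition _ := [isSub for bop_fun].
HB.instance Definition _ := [Choice of boundedOp by <:].

Fact bounded_op_submod_closed : submod_closed bounded_op.
Proof.
split=> [|a f g]; rewrite ?inE.
  split=> [b x y|]; first by rewrite /= scaler0 addr0.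
  by exists 0 => x; rewrite /= rnorm0 mul0r.
move=> [lf [M hM]] [lg [K hK]]; split=> [b x y|].
  rewrite !fctE lf lg !scalerDr !scalerA [b * a]mulrC.
  by rewrite addrACA.
exists (rnorm a * M + K) => x; rewrite !fctE.
apply: le_trans (rnormD _ _) _; rewrite rnormZ mulrDl -mulrA.
by rewrite lerD // ler_wpM2l // rnorm_ge0.
Qed.

HB.instance Definition _ :=
  GRing.isSubmodClosed.Build R[i] (X -> Y) bounded_op bounded_op_submod_closed.
HB.instance Definition _ := [SubChoice_isSubLmodule of boundedOp by <:].

Implicit Types f g : boundedOp.

Lemma bop_linear f : linear f.
Proof. by have := bopP f; rewrite inE => -[]. Qed.

Lemma bop_bounded f : exists M, forall x, rnorm (f x) <= M * rnorm x.
Proof. by have := bopP f; rewrite inE => -[]. Qed.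

Lemma bopD f g x : (f + g) x = f x + g x. Proof. by []. Qed.
Lemma bopZ a f x : (a *: f) x = a *: f x. Proof. by []. Qed.
Lemma bopB f g x : (f - g) x = f x - g x. Proof. by []. Qed.

Lemma bop_ext f g : f =1 g -> f = g.
Proof. by move=> fg; apply/val_inj/funext. Qed.

Lemma bop_scale f a x : f (a *: x) = a *: f x.
Proof.
have f0 : f 0 = 0.
  have := bop_linear f 1 0 0; rewrite !scale1r addr0 => /eqP.
  by rewrite -subr_eq0 opprD addNKr oppr_eq0 => /eqP.
by have := bop_linear f a x 0; rewrite !addr0 f0 addr0.
Qed.

Lemma bop0 f : f 0 = 0.
Proof. by have := bop_scale f 0 0; rewrite !scale0r. Qed.

Lemma bop_add f x y : f (x + y) = f x + f y.
Proof. by have := bop_linear f 1 x y; rewrite !scale1r. Qed.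

Definition opnorm (f : X -> Y) : R :=
  sup [set rnorm (f x) | x in [set x | rnorm x <= 1]].

Lemma opnorm_has_sup f : has_sup [set rnorm (f x) | x in [set x | rnorm x <= 1]].
Proof.
split; first by exists (rnorm (f 0)), 0 => //=; rewrite rnorm0.
have [M hM] := bop_bounded f; exists `|M| => _ [x /= x1 <-].
apply: le_trans (hM x) _; apply: le_trans (_ : `|M| * rnorm x <= _).
  by rewrite ler_wpM2r ?rnorm_ge0 // ler_norm.
by rewrite ler_piMr.
Qed.

Lemma opnormP f x : rnorm (f x) <= opnorm f * rnorm x.
Proof.
have [x0|/eqP x0] := eqVneq (rnorm x) 0.
  have [M /(_ x)] := bop_bounded f; by rewrite x0 !mulr0.
have xgt0 : 0 < rnorm x by rewrite lt_neqAle rnorm_ge0 andbT eq_sym; apply/eqP.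
rewrite -ler_pdivrMr // mulrC.
have -> : (rnorm x)^-1 * rnorm (f x) = rnorm (f ((rnorm x)^-1%:C%C *: x)).
  by rewrite bop_scale rnormZ rnormR ger0_norm // invr_ge0 ltW.
apply: (ub_le_sup (proj2 (opnorm_has_sup f))).
exists ((rnorm x)^-1%:C%C *: x) => //=.
rewrite rnormZ rnormR ger0_norm; last by rewrite invr_ge0 ltW.
by rewrite mulVf // gt_eqF.
Qed.

Lemma opnorm_le f M : 0 <= M -> (forall x, rnorm (f x) <= M * rnorm x) ->
  opnorm f <= M.
Proof.
move=> M0 hM; apply: ge_sup; first exact: (proj1 (opnorm_has_sup f)).
by move=> _ [x /= x1 <-]; apply: le_trans (hM x) _; rewrite ler_piMr.
Qed.

Lemma opnorm_ge0 f : 0 <= opnorm f.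
Proof.
apply: (ub_le_sup (proj2 (opnorm_has_sup f))).
have f0 : f 0 = 0 by have := bop_scale f 0 0; rewrite !scale0r.
by exists 0 => /=; rewrite ?f0 rnorm0 ?ler01.
Qed.

Fact opnormD f g : (opnorm (f + g))%:C%C <= (opnorm f)%:C%C + (opnorm g)%:C%C.
Proof.
rewrite -rmorphD lecR; apply: opnorm_le; first by apply: addr_ge0; apply: opnorm_ge0.
move=> x; rewrite bopD mulrDl; apply: le_trans (rnormD _ _) _.
by rewrite lerD // opnormP.
Qed.

Lemma opnormZ_le a f : opnorm (a *: f) <= rnorm a * opnorm f.
Proof.
apply: opnorm_le => [|x]; first by apply: mulr_ge0; [apply: rnorm_ge0 | apply: opnorm_ge0].
by rewrite bopZ rnormZ -mulrA ler_wpM2l ?rnorm_ge0 // opnormP.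
Qed.

Fact opnormZ (a : R[i]) f :
  (opnorm (a *: f))%:C%C = `|a| * (opnorm f)%:C%C :> R[i].
Proof.
rewrite rnormE -rmorphM; congr (_ %:C)%C; apply/eqP; rewrite eq_le opnormZ_le /=.
have [->|a0] := eqVneq a 0; first by rewrite rnorm0 mul0r; apply: (opnorm_ge0 (0 *: f)).
have agt0 : 0 < rnorm a.
  by rewrite lt_neqAle rnorm_ge0 andbT eq_sym; apply: contra a0 => /eqP/rnorm0_eq0/eqP.
have := opnormZ_le a^-1 (a *: f); rewrite scalerA mulVf // scale1r.
rewrite -(ler_pM2l agt0) => h; apply: le_trans h _.
by rewrite mulrA -rnormM mulfV // rnorm1 mul1r.
Qed.

Fact opnorm0 f : (opnorm f)%:C%C = 0 :> R[i] -> f = 0.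
Proof.
case=> f0; apply: bop_ext => x; apply/rnorm0_eq0/eqP; rewrite eq_le rnorm_ge0 andbT.
by have := opnormP f x; rewrite f0 mul0r.
Qed.

HB.instance Definition _ := Lmodule_isNormed.Build R[i] boundedOp
  opnormD opnormZ opnorm0.

Lemma rnorm_opE f : rnorm f = opnorm f.
Proof. by []. Qed.

End BoundedOp.
Arguments bounded_op {R X Y}.

Section BoundedOpComplete.
Variables (R : realType) (X : normedModType R[i]).
Variable Y : completeNormedModType R[i].

Fact boundedOp_sn_complete : sn_complete (rnorm_seminorm (boundedOp X Y)).
Proof.
move=> u cu.
have /choice [l hl] x : exists l : Y, sn_cvg (rnorm_seminorm Y) (u^~ x) l.
  apply: banach_complete => e e0.
  have d0 : 0 < rnorm x + 1 by rewrite ltr_wpDl ?rnorm_ge0.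
  have [K hK] := cu (e / (rnorm x + 1)) (divr_gt0 e0 d0).
  exists K => m n /hK h /h /=; rewrite rnorm_opE ler_pdivlMr // => {}h.
  have := opnormP (u m - u n) x; rewrite bopB => h'; apply: le_trans h' _.
  have := rnorm_ge0 x; have := opnorm_ge0 (u m - u n).
  nra.
have lim_le x a b K : (forall n, (K <= n)%N -> rnorm (u n x - a) <= b) ->
    rnorm (l x - a) <= b.
  move=> h; apply/ler_addgt0Pr => e e0; have [N hN] := hl x e e0.
  have := hN _ (leq_maxl N K); have := h _ (leq_maxr N K).
  have := sn_tri (rnorm_seminorm Y) (u (maxn N K) x) (l x) a.
  rewrite /= (rnormC (u _ x) (l x)); lra.
have ll : linear l.
  move=> a x y; apply/eqP; rewrite -subr_eq0; apply/eqP/rnorm0_eq0/eqP.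
  rewrite eq_le rnorm_ge0 andbT; apply/ler_addgt0Pr => e e0; rewrite add0r.
  have d0 : 0 < rnorm a + 2 by rewrite ltr_wpDl ?rnorm_ge0.
  have e10 := divr_gt0 e0 d0.
  have [N1 h1] := hl (a *: x + y) _ e10; have [N2 h2] := hl x _ e10.
  have [N3 h3] := hl y _ e10; pose N := maxn N1 (maxn N2 N3).
  have {}h1 := h1 N (leq_maxl _ _).
  have {}h2 := h2 N (leq_trans (leq_maxl _ _) (leq_maxr _ _)).
  have {}h3 := h3 N (leq_trans (leq_maxr _ _) (leq_maxr _ _)).
  rewrite /= bop_linear in h1; rewrite /= in h2 h3.
  have -> : l (a *: x + y) - (a *: l x + l y) =
    - (a *: u N x + u N y - l (a *: x + y)) +
    (a *: (u N x - l x) + (u N y - l y)).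
    by rewrite scalerBr addrACA opprB -opprD addrA subrK.
  apply: le_trans (rnormD _ _) _; rewrite rnormN.
  have := rnormD (a *: (u N x - l x)) (u N y - l y); rewrite rnormZ.
  have -> : e = e / (rnorm a + 2) * (rnorm a + 2) by rewrite mulfVK // gt_eqF.
  have := rnorm_ge0 a; nra.
have bl : exists M, forall x, rnorm (l x) <= M * rnorm x.
  have [K hK] := cu 1 ltr01; exists (1 + opnorm (u K)) => x.
  have h n : (K <= n)%N -> rnorm (u n x - u K x) <= 1 * rnorm x.
    move=> Kn; have := hK n K Kn (leqnn _); rewrite /= rnorm_opE => h.
    by rewrite -bopB (le_trans (opnormP _ _)) // ler_wpM2r ?rnorm_ge0.
  have := lim_le x _ _ _ h; have := opnormP (u K) x.
  have := rnormD (l x - u K x) (u K x); rewrite subrK; lra.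
have lP : l \in bounded_op by rewrite inE.
exists (BoundedOp lP) => e e0; have [K hK] := cu e e0; exists K => n Kn.
rewrite /= rnorm_opE; apply: opnorm_le => [|x]; first exact: ltW.
rewrite bopB rnormC; apply: (lim_le _ _ _ K) => m Km.
rewrite -bopB (le_trans (opnormP _ _)) // ler_wpM2r ?rnorm_ge0 //.
exact: hK.
Qed.

HB.instance Definition _ := Uniform_isComplete.Build (boundedOp X Y)
  (sn_complete_cvg boundedOp_sn_complete).

End BoundedOpComplete.

Section Composition.
Variable R : realType.

Fact idop_subproof (X : normedModType R[i]) : (fun x : X => x) \in bounded_op.
Proof. by rewrite inE; split=> //; exists 1 => x; rewrite mul1r. Qed.

Definition idop (X : normedModType R[i]) := BoundedOp (idop_subproof X).

Variables X Y Z : normedModType R[i].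

Fact compop_subproof (f : boundedOp Y Z) (g : boundedOp X Y) :
  (fun x : X => f (g x)) \in bounded_op.
Proof.
rewrite inE; split=> [a x y|]; first by rewrite !bop_linear.
exists (opnorm f * opnorm g) => x; apply: le_trans (opnormP _ _) _.
by rewrite -mulrA ler_wpM2l ?opnorm_ge0 // opnormP.
Qed.

Definition compop (f : boundedOp Y Z) (g : boundedOp X Y) :=
  BoundedOp (compop_subproof f g).

Lemma compopE f g x : compop f g x = f (g x).
Proof. by []. Qed.

Lemma opnorm_comp f g : opnorm (compop f g) <= opnorm f * opnorm g.
Proof.
apply: opnorm_le => [|x]; first by apply: mulr_ge0; apply: opnorm_ge0.
rewrite -mulrA (le_trans (opnormP f _)) //.
by rewrite ler_wpM2l ?opnorm_ge0 // opnormP.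
Qed.

End Composition.

Section Ultraproduct.
Variables (R : realType) (I : Type).
Variables (U : set_system I) (UU : UltraFilter U).
Variable X : I -> completeNormedModType R[i].

Record bounded_family : Type := BoundedFamily {
  bf_fun :> forall i, X i;
  bfP : exists M, forall i, rnorm (bf_fun i) <= M }.

Implicit Types x y : bounded_family.

Lemma bf_ext x y : (forall i, x i = y i) -> x = y.
Proof.
case: x y => [x xP] [y yP] /= xy.
have {}xy : x = y by apply: functional_extensionality_dep.
by rewrite xy in xP *; congr BoundedFamily; exact: Prop_irrelevance.
Qed.

HB.instance Definition _ := gen_eqMixin bounded_family.
HB.instance Definition _ := gen_choiceMixin bounded_family.

Fact bf0P : exists M, forall i, rnorm (0 : X i) <= M.
Proof. by exists 0 => i; rewrite rnorm0 lexx. Qed.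

Fact bfNP x : exists M, forall i, rnorm (- x i) <= M.
Proof. by have [M h] := bfP x; exists M => i; rewrite rnormN. Qed.

Fact bfDP x y : exists M, forall i, rnorm (x i + y i) <= M.
Proof.
have [M h] := bfP x; have [K k] := bfP y; exists (M + K) => i.
by rewrite (le_trans (rnormD _ _)) // lerD.
Qed.

Fact bfZP (a : R[i]) x : exists M, forall i, rnorm (a *: x i) <= M.
Proof.
have [M h] := bfP x; exists (rnorm a * M) => i.
by rewrite rnormZ; apply: ler_wpM2l (rnorm_ge0 a) _ _ (h i).
Qed.

Definition bf0 := BoundedFamily bf0P.
Definition bfN x := BoundedFamily (bfNP x).
Definition bfD x y := BoundedFamily (bfDP x y).
Definition bfZ a x := BoundedFamily (bfZP a x).

Fact bfDA : associative bfD.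
Proof. by move=> x y z; apply: bf_ext => i /=; rewrite addrA. Qed.
Fact bfDC : commutative bfD.
Proof. by move=> x y; apply: bf_ext => i /=; rewrite addrC. Qed.
Fact bf0D : left_id bf0 bfD.
Proof. by move=> x; apply: bf_ext => i /=; rewrite add0r. Qed.
Fact bfND : left_inverse bf0 bfN bfD.
Proof. by move=> x; apply: bf_ext => i /=; rewrite addNr. Qed.
HB.instance Definition _ :=
  GRing.isZmodule.Build bounded_family bfDA bfDC bf0D bfND.

Fact bfZA a b x : bfZ a (bfZ b x) = bfZ (a * b) x.
Proof. by apply: bf_ext => i /=; rewrite scalerA. Qed.
Fact bfZ1 : left_id 1 bfZ.
Proof. by move=> x; apply: bf_ext => i /=; rewrite scale1r. Qed.
Fact bfZDr : right_distributive bfZ +%R.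
Proof. by move=> a x y; apply: bf_ext => i /=; rewrite scalerDr. Qed.
Fact bfZDl x : {morph bfZ^~ x : a b / a + b}.
Proof. by move=> a b; apply: bf_ext => i /=; rewrite scalerDl. Qed.
HB.instance Definition _ :=
  GRing.Zmodule_isLmodule.Build R[i] bounded_family bfZA bfZ1 bfZDr bfZDl.

Lemma ultra_cvg (f : I -> R) (M : R) :
  (forall i, 0 <= f i <= M) -> cvg (f i @[i --> U]).
Proof.
move=> fM.
have fU : UltraFilter (f @ U).
  split; first exact: fmap_proper_filter.
  move=> G PG fG; apply/seteqP; split=> // A GA.
  have [//|nA] := in_ultra_setVsetC (f @^-1` A) UU.
  by have [z []] := filter_ex (filterI GA (fG (~` A) nA)).
have : compact `[0, M]%classic by exact: segment_compact.
rewrite compact_ultra => /(_ _ fU) [|l [_ hl]]; last by apply/cvg_ex; exists l.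
by apply: (@filterE _ U) => i; rewrite /= in_itv /=; exact: fM.
Qed.

Definition ultra_norm x : R := lim (rnorm (x i) @[i --> U]).

Lemma ultra_norm_cvg x : rnorm (x i) @[i --> U] --> ultra_norm x.
Proof.
have [M h] := bfP x; apply: (@ultra_cvg _ M) => i.
by rewrite rnorm_ge0 h.
Qed.

Lemma ultra_norm_le x M : U [set i | rnorm (x i) <= M] -> ultra_norm x <= M.
Proof.
move=> h; apply: limr_le h; apply/cvg_ex; exists (ultra_norm x); exact: ultra_norm_cvg.
Qed.

Lemma ultra_norm_lt x M : ultra_norm x < M -> U [set i | rnorm (x i) < M].
Proof. by move=> h; exact: (cvgr_lt _ (@ultra_norm_cvg x) _ h). Qed.

Fact ultra_normD x y : ultra_norm (x + y) <= ultra_norm x + ultra_norm y.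
Proof.
apply/ler_addgt0Pr => e e0; apply: ultra_norm_le.
have e20 : 0 < e / 2 by apply: divr_gt0.
have hx : ultra_norm x < ultra_norm x + e / 2 by rewrite ltrDl.
have hy : ultra_norm y < ultra_norm y + e / 2 by rewrite ltrDl.
apply: filterS2 (ultra_norm_lt hx) (ultra_norm_lt hy) => i /= h k.
by have := rnormD (x i) (y i); lra.
Qed.

Fact ultra_normZ (a : R[i]) x : ultra_norm (a *: x) = rnorm a * ultra_norm x.
Proof.
apply/cvg_lim => //; under eq_fun do rewrite /= rnormZ.
by apply: cvgMr; exact: ultra_norm_cvg.
Qed.

Definition ultra_seminorm := Seminorm ultra_normD ultra_normZ.

Fact ultra_sn_complete : sn_complete ultra_seminorm.
Proof.
apply: fast_complete => u hu; pose w n := u n.+1.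
pose A n := [set i | rnorm (w n.+1 i - w n i) < 2^-1 ^+ n].
have UA n : U (A n).
  apply: (@ultra_norm_lt (w n.+1 - w n)); apply: le_lt_trans (hu n.+1) _.
  by have := half_gt0 R n; rewrite exprS; lra.
pose B n := \bigcap_(k in `I_n) A k.
have UB n : U (B n).
  elim: n => [|n IH].
    by rewrite /B II0 bigcap_set0; exact: filterT.
  by rewrite /B IIS bigcap_setU bigcap_set1; apply: filterI.
pose fix v (n : nat) (i : I) {struct n} : X i :=
  if n is m.+1 then if `[< B m.+1 i >] then w m.+1 i else v m i else w 0%N i.
have vB n i : B n i -> v n i = w n i.
  by case: n => [//|n] h /=; rewrite asboolT.
have dv i n : rnorm (v n.+1 i - v n i) <= 2^-1 ^+ n.
  rewrite [v n.+1 i]/=; case: asboolP => h; last first.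
    by rewrite subrr rnorm0 ltW // half_gt0.
  rewrite vB; last by move=> k /= kn; apply: h; rewrite /= ltnW.
  by apply: ltW; apply: (h n) => /=.
have hv : forall i, exists l : X i,
    sn_cvg (rnorm_seminorm (X i)) (v^~ i) l.
  by move=> i; apply: banach_complete; apply: fast_cauchy; exact: dv.
pose l i := projT1 (cid (hv i)).
have hl i : sn_cvg (rnorm_seminorm (X i)) (v^~ i) (l i).
  exact: (projT2 (cid (hv i))).
have dl i n : rnorm (v n i - l i) <= 2 * 2^-1 ^+ n.
  exact: (@fast_lim _ _ (rnorm_seminorm (X i)) (v^~ i) (l i) (dv i) (hl i)).
have lP : exists M, forall i, rnorm (l i) <= M.
  have [M hM] := bfP (w 0%N); exists (M + 2) => i.
  have := dl i 0%N; have := hM i; rewrite expr0 mulr1 /= rnormC.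
  have := rnormD (l i - w 0%N i) (w 0%N i); rewrite subrK; lra.
exists (BoundedFamily lP) => e e0; have e20 : 0 < e / 2 by apply: divr_gt0.
have [N hN] := half_small e20; exists N.+1 => -[//|n] Nn.
apply: ultra_norm_le; apply: filterS (UB n) => i /vB /= uv.
by have := dl i n; have := hN n Nn; rewrite uv; lra.
Qed.

(* The Banach space ultraproduct: bounded families modulo the families whose
   norms tend to 0 along U. *)
Definition ultraproduct : completeNormedModType R[i] :=
  sepquot (CompleteSeminorm ultra_sn_complete).

End Ultraproduct.

Record algebra_seminorm (R : realType) (W : lalgType R[i]) := AlgebraSeminorm {
  asn :> seminorm W;
  asnM : forall a b, asn (a * b) <= asn a * asn b }.

Section Completion.
Variables (R : realType) (W : lalgType R[i]) (p : algebra_seminorm W).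

Record cauchy_seq : Type := CauchySeq {
  cs_fun :> nat -> W;
  csP : sn_cauchy p cs_fun }.

Implicit Types x y z : cauchy_seq.

Lemma cs_ext x y : (forall n, x n = y n) -> x = y.
Proof.
case: x y => [x xP] [y yP] /= xy; have {}xy : x = y by apply/funext.
by rewrite xy in xP *; congr CauchySeq; exact: Prop_irrelevance.
Qed.

HB.instance Definition _ := gen_eqMixin cauchy_seq.
HB.instance Definition _ := gen_choiceMixin cauchy_seq.

Lemma cs_bounded x : exists2 M, 0 <= M & forall n, p (x n) <= M.
Proof.
have [N hN] := csP x ltr01.
exists (\sum_(k < N.+1) p (x k) + 1).
  by rewrite addr_ge0 // sumr_ge0 // => i _; exact: sn_ge0.
move=> n; have le_sum k : (k <= N)%N -> p (x k) <= \sum_(k < N.+1) p (x k).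
  move=> kN; rewrite (bigD1 (Ordinal (kN : (k < N.+1)%N))) //= lerDl.
  by rewrite sumr_ge0 // => i _; exact: sn_ge0.
have [nN|/ltnW Nn] := leqP n N; first by have := le_sum n nN; lra.
have := le_sum N (leqnn _); have := hN n N Nn (leqnn _).
have := snD p (x n - x N) (x N); rewrite subrK; lra.
Qed.

Fact cs_cstP (a : W) : sn_cauchy p (fun=> a).
Proof. by move=> e e0; exists 0%N => m n _ _; rewrite subrr sn0 ltW. Qed.

Fact csNP x : sn_cauchy p (fun n => - x n).
Proof.
move=> e /(csP x) [N hN]; exists N => m n Nm Nn.
by rewrite -opprD snN hN.
Qed.

Fact csDP x y : sn_cauchy p (fun n => x n + y n).
Proof.
move=> e e0; have e20 : 0 < e / 2 by apply: divr_gt0.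
have [N hN] := csP x e20; have [K hK] := csP y e20.
exists (maxn N K) => m n; rewrite !geq_max => /andP[Nm Km] /andP[Nn Kn].
rewrite opprD addrACA; have := snD p (x m - x n) (y m - y n).
have := hN m n Nm Nn; have := hK m n Km Kn; lra.
Qed.

Fact csZP (a : R[i]) x : sn_cauchy p (fun n => a *: x n).
Proof.
move=> e e0; have d0 : 0 < rnorm a + 1 by rewrite ltr_wpDl ?rnorm_ge0.
have [N hN] := csP x (divr_gt0 e0 d0); exists N => m n Nm Nn.
have := hN m n Nm Nn; rewrite -scalerBr snZ ler_pdivlMr //.
have := sn_ge0 p (x m - x n); have := rnorm_ge0 a; nra.
Qed.

Fact csMP x y : sn_cauchy p (fun n => x n * y n).
Proof.
move=> e e0; have [M M0 hM] := cs_bounded x; have [K K0 hK] := cs_bounded y.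
have d0 : 0 < M + K + 1 by lra.
have e1 : 0 < e / (M + K + 1) by apply: divr_gt0.
have [N1 h1] := csP x e1; have [N2 h2] := csP y e1.
exists (maxn N1 N2) => m n; rewrite !geq_max => /andP[Nm Km] /andP[Nn Kn].
have {}h1 := h1 m n Nm Nn; have {}h2 := h2 m n Km Kn.
have -> : x m * y m - x n * y n = (x m - x n) * y m + x n * (y m - y n).
  by rewrite mulrBl mulrBr addrA subrK.
apply: le_trans (snD _ _ _) _.
have a1 := asnM p (x m - x n) (y m); have a2 := asnM p (x n) (y m - y n).
have a3 := hM n; have a4 := hK m.
have a5 : p (x m - x n) * p (y m) <= e / (M + K + 1) * K.
  by apply: ler_pM => //; apply: sn_ge0.
have a6 : p (x n) * p (y m - y n) <= M * (e / (M + K + 1)).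
  by apply: ler_pM => //; apply: sn_ge0.
have a7 : e / (M + K + 1) * (M + K + 1) = e by rewrite mulfVK // gt_eqF.
nra.
Qed.

Definition cs_cst a := CauchySeq (cs_cstP a).
Definition csN x := CauchySeq (csNP x).
Definition csD x y := CauchySeq (csDP x y).
Definition csZ a x := CauchySeq (csZP a x).
Definition csM x y := CauchySeq (csMP x y).

Fact csDA : associative csD.
Proof. by move=> x y z; apply: cs_ext => n /=; rewrite addrA. Qed.
Fact csDC : commutative csD.
Proof. by move=> x y; apply: cs_ext => n /=; rewrite addrC. Qed.
Fact cs0D : left_id (cs_cst 0) csD.
Proof. by move=> x; apply: cs_ext => n /=; rewrite add0r. Qed.
Fact csND : left_inverse (cs_cst 0) csN csD.
Proof. by move=> x; apply: cs_ext => n /=; rewrite addNr. Qed.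
HB.instance Definition _ := GRing.isZmodule.Build cauchy_seq csDA csDC cs0D csND.

Fact csZA a b x : csZ a (csZ b x) = csZ (a * b) x.
Proof. by apply: cs_ext => n /=; rewrite scalerA. Qed.
Fact csZ1 : left_id 1 csZ.
Proof. by move=> x; apply: cs_ext => n /=; rewrite scale1r. Qed.
Fact csZDr : right_distributive csZ +%R.
Proof. by move=> a x y; apply: cs_ext => n /=; rewrite scalerDr. Qed.
Fact csZDl x : {morph csZ^~ x : a b / a + b}.
Proof. by move=> a b; apply: cs_ext => n /=; rewrite scalerDl. Qed.
HB.instance Definition _ :=
  GRing.Zmodule_isLmodule.Build R[i] cauchy_seq csZA csZ1 csZDr csZDl.

Definition cs_norm x : R := lim (p (x n) @[n --> \oo]).

Lemma cs_norm_cvg x : p (x n) @[n --> \oo] --> cs_norm x.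
Proof.
apply: cauchy_cvg; apply/cauchyP => e e0; have e20 : 0 < e / 2 by apply: divr_gt0.
have [N hN] := csP x e20; exists (p (x N)); exists N => // n /= Nn.
rewrite /ball /=; have := sn_lip p (x N) (x n); have := hN N n (leqnn _) Nn.
lra.
Qed.

Lemma cs_norm_le x M N : (forall n, (N <= n)%N -> p (x n) <= M) ->
  cs_norm x <= M.
Proof.
move=> h; apply: limr_le; last by exists N.
by apply/cvg_ex; exists (cs_norm x); exact: cs_norm_cvg.
Qed.

Lemma cs_norm_lt x M : cs_norm x < M ->
  exists N, forall n, (N <= n)%N -> p (x n) < M.
Proof.
by move=> h; have [N _ hN] := cvgr_lt _ (@cs_norm_cvg x) _ h; exists N.
Qed.

Fact cs_normD x y : cs_norm (x + y) <= cs_norm x + cs_norm y.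
Proof.
apply/ler_addgt0Pr => e e0; have e20 : 0 < e / 2 by apply: divr_gt0.
have hx : cs_norm x < cs_norm x + e / 2 by rewrite ltrDl.
have hy : cs_norm y < cs_norm y + e / 2 by rewrite ltrDl.
have [N1 h1] := cs_norm_lt hx; have [N2 h2] := cs_norm_lt hy.
apply: (@cs_norm_le _ _ (maxn N1 N2)) => n; rewrite geq_max => /andP[/h1 a /h2 b].
have := snD p (x n) (y n); lra.
Qed.

Fact cs_normZ (a : R[i]) x : cs_norm (a *: x) = rnorm a * cs_norm x.
Proof.
apply/cvg_lim => //; under eq_fun do rewrite /= snZ.
by apply: cvgMr; exact: cs_norm_cvg.
Qed.

Definition cs_seminorm := Seminorm cs_normD cs_normZ.

Fact cs_sn_complete : sn_complete cs_seminorm.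
Proof.
move=> u cu; have /choice [f hf] k := csP (u k) (half_gt0 R k).
pose l k := u k (f k).
have cl : sn_cauchy p l.
  move=> e e0; have e40 : 0 < e / 4 by apply: divr_gt0.
  have [N1 h1] := cu _ e40; have [N2 h2] := half_small e40.
  exists (maxn N1 N2) => j k; rewrite !geq_max => /andP[j1 j2] /andP[k1 k2].
  have [|N hN] := @cs_norm_lt (u j - u k) (e / 2).
    by apply: le_lt_trans (h1 j k j1 k1) _; lra.
  pose n := maxn N (maxn (f j) (f k)).
  have a1 := hN n (leq_maxl _ _).
  have fjn : (f j <= n)%N by rewrite !leq_max leqnn !orbT.
  have fkn : (f k <= n)%N by rewrite !leq_max leqnn !orbT.
  have a2 := hf j (f j) n (leqnn _) fjn; have a3 := hf k n (f k) fkn (leqnn _).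
  have a4 := sn_tri p (u j n) (l j) (l k).
  have a5 := sn_tri p (u k n) (u j n) (l k).
  have := h2 j j2; have := h2 k k2; rewrite /= in a1.
  rewrite -/(l j) in a2; rewrite -/(l k) in a3; lra.
exists (CauchySeq cl) => e e0; have e20 : 0 < e / 2 by apply: divr_gt0.
have [N1 h1] := cl _ e20; have [N2 h2] := half_small e20.
exists (maxn N1 N2) => k; rewrite geq_max => /andP[k1 k2].
apply: (@cs_norm_le _ _ (maxn N1 (f k))) => n.
rewrite geq_max => /andP[n1 n2] /=.
have := sn_tri p (l k) (u k n) (l n); have := h1 k n k1 n1.
have := hf k n (f k) n2 (leqnn _); have := h2 k k2; rewrite -/(l k); lra.
Qed.

Definition cs_complete_seminorm := CompleteSeminorm cs_sn_complete.

(* The Hausdorff completion of W for p: Cauchy sequences of W modulo those with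
   p (x n) --> 0, with the termwise product.  It may be the zero ring. *)
Definition completion : Type := sepquot cs_complete_seminorm.

HB.instance Definition _ := CompleteNormedModule.on completion.

Definition completion_seq (a : completion) : cauchy_seq := sepquot_repr a.

Definition completion_of_seq (x : cauchy_seq) : completion :=
  sepquot_pi cs_complete_seminorm x.

Definition to_completion (a : W) : completion := completion_of_seq (cs_cst a).

Local Notation pi := completion_of_seq.

Lemma pi_eqP x y : pi x = pi y <-> cs_norm (x - y) = 0.
Proof. exact: sepquot_eqP. Qed.

Lemma cs_norm_ge0 x : 0 <= cs_norm x.
Proof. exact: (sn_ge0 cs_seminorm). Qed.

Lemma cs_normM x y : cs_norm (csM x y) <= cs_norm x * cs_norm y.
Proof.
have h : p (x n) * p (y n) @[n --> \oo] --> cs_norm x * cs_norm y.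
  by apply: cvgM; exact: cs_norm_cvg.
rewrite -(cvg_lim _ h) //; apply: ler_lim.
- by apply/cvg_ex; exists (cs_norm (csM x y)); exact: cs_norm_cvg.
- by apply/cvg_ex; eexists; exact: h.
- by apply: nearW => n; exact: asnM.
Qed.

Lemma completion_seqK a : pi (completion_seq a) = a.
Proof. exact: sepquot_reprK. Qed.

Definition completion_mul (a b : completion) : completion :=
  pi (csM (completion_seq a) (completion_seq b)).

Lemma pi_mul x y : completion_mul (pi x) (pi y) = pi (csM x y).
Proof.
apply/pi_eqP; set x' := completion_seq _; set y' := completion_seq _.
have hx : cs_norm (x' - x) = 0 by apply/pi_eqP; rewrite completion_seqK.
have hy : cs_norm (y' - y) = 0 by apply/pi_eqP; rewrite completion_seqK.
have -> : csM x' y' - csM x y = csM (x' - x) y' + csM x (y' - y).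
  by apply: cs_ext => n /=; rewrite mulrBl mulrBr addrA subrK.
apply/eqP; rewrite eq_le cs_norm_ge0 andbT; apply: le_trans (cs_normD _ _) _.
have := cs_normM (x' - x) y'; have := cs_normM x (y' - y).
rewrite hx hy mul0r mulr0; lra.
Qed.

Lemma pi_add x y : pi (csD x y) = pi x + pi y.
Proof. exact: sepquot_piD. Qed.

Fact completion_mulA : associative completion_mul.
Proof.
move=> a b c; rewrite -(completion_seqK a) -(completion_seqK b).
rewrite -(completion_seqK c) !pi_mul; congr pi.
by apply: cs_ext => n /=; rewrite mulrA.
Qed.

Fact completion_mul1 : left_id (to_completion 1) completion_mul.
Proof.
move=> a; rewrite -(completion_seqK a) pi_mul; congr pi.
by apply: cs_ext => n /=; rewrite mul1r.
Qed.

Fact completion_mulr1 : right_id (to_completion 1) completion_mul.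
Proof.
move=> a; rewrite -(completion_seqK a) pi_mul; congr pi.
by apply: cs_ext => n /=; rewrite mulr1.
Qed.

Fact completion_mulDl : left_distributive completion_mul +%R.
Proof.
move=> a b c; rewrite -(completion_seqK a) -(completion_seqK b).
rewrite -(completion_seqK c) -pi_add !pi_mul -pi_add; congr pi.
by apply: cs_ext => n /=; rewrite mulrDl.
Qed.

Fact completion_mulDr : right_distributive completion_mul +%R.
Proof.
move=> a b c; rewrite -(completion_seqK a) -(completion_seqK b).
rewrite -(completion_seqK c) -pi_add !pi_mul -pi_add; congr pi.
by apply: cs_ext => n /=; rewrite mulrDr.
Qed.

HB.instance Definition _ := GRing.Zmodule_isPzRing.Build completion
  completion_mulA completion_mul1 completion_mulr1
  completion_mulDl completion_mulDr.

Lemma to_completionB a b :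
  to_completion (a - b) = to_completion a - to_completion b.
Proof. by rewrite -[RHS]sepquot_piB; congr pi; apply: cs_ext. Qed.

Lemma to_completionM a b :
  to_completion (a * b) = to_completion a * to_completion b.
Proof. by rewrite [RHS]pi_mul; congr pi; apply: cs_ext. Qed.

Lemma rnorm_to_completion a : rnorm (to_completion a) = p a.
Proof. rewrite [LHS]sepquot_rnormE; exact (@lim_cst R (@Rhausdorff R) nat \oo _ (p a)). Qed.

Lemma completion_seq_cvg a : to_completion (completion_seq a n) @[n --> \oo] --> a.
Proof.
apply/sn_cvgP => e /(csP (completion_seq a)) [N hN]; exists N => n Nn.
rewrite -{2}(completion_seqK a) /= -[X in rnorm X]sepquot_piB.
rewrite [X in X <= _]sepquot_rnormE; apply: (@cs_norm_le _ _ N) => m Nm /=.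
exact: hN.
Qed.

End Completion.

(* The group algebra C[G]: finitely supported functions on G with convolution.
   The library puts a product on {malg R[K]} only for a monoid K in which
   x * y = 1 forces x = y = 1, so the product is built here. *)
Definition group_algebra (R : realType) (G : groupType) : Type :=
  {malg R[i][G]}.

Section GroupAlgebra.
Variables (R : realType) (G : groupType).
Local Notation A := (group_algebra R G).

HB.instance Definition _ := GRing.Lmodule.on A.

Implicit Types a b c : A.

Definition ga_mul a b : A := \sum_(g <- msupp a) \sum_(h <- msupp b)
  << a@_g * b@_h *g (g * h)%g >>.

Definition ga_one : A := << 1 *g 1%g >>.

Lemma ga_mulw (d1 d2 : {fset G}) a b : (msupp a `<=` d1)%fset -> (msupp b `<=` d2)%fset ->
  ga_mul a b = \sum_(g <- d1) \sum_(h <- d2) << a@_g * b@_h *g (g * h)%g >>.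
Proof.
move=> le1 le2; rewrite /ga_mul (big_fset_incl _ le1) /=.
  apply/eq_bigr=> g _; apply/big_fset_incl => // h _ /mcoeff_outdom ->.
  by rewrite mulr0 monalgU0.
move=> g _ /mcoeff_outdom ag.
by rewrite big1 => // h _; rewrite ag mul0r monalgU0.
Qed.

Lemma ga_mulDl : left_distributive ga_mul +%R.
Proof.
move=> a b c; pose d := (msupp a `|` msupp b)%fset.
rewrite !(@ga_mulw d (msupp c)) ?fsubset_refl ?fsubsetUl ?fsubsetUr ?msuppD_le //.
rewrite -big_split /=; apply/eq_bigr=> g _; rewrite -big_split /=.
by apply/eq_bigr=> h _; rewrite mcoeffD mulrDl monalgUD.
Qed.

Lemma ga_mulDr : right_distributive ga_mul +%R.
Proof.
move=> c a b; pose d := (msupp a `|` msupp b)%fset.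
rewrite !(@ga_mulw (msupp c) d) ?fsubset_refl ?fsubsetUl ?fsubsetUr ?msuppD_le //.
rewrite -big_split /=; apply/eq_bigr=> g _; rewrite -big_split /=.
by apply/eq_bigr=> h _; rewrite mcoeffD mulrDr monalgUD.
Qed.

Lemma ga_mul0l b : ga_mul 0 b = 0.
Proof. by rewrite /ga_mul msupp0 big_seq_fset0. Qed.

Lemma ga_mul0r a : ga_mul a 0 = 0.
Proof. by apply: (addIr (ga_mul a 0)); rewrite -ga_mulDr !add0r. Qed.

Lemma ga_mul_suml (I : Type) (s : seq I) (F : I -> A) b :
  ga_mul (\sum_(i <- s) F i) b = \sum_(i <- s) ga_mul (F i) b.
Proof.
by apply: (big_morph (ga_mul^~ b)) => [x y|]; [exact: ga_mulDl|exact: ga_mul0l].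
Qed.

Lemma ga_mul_sumr (I : Type) (s : seq I) (F : I -> A) a :
  ga_mul a (\sum_(i <- s) F i) = \sum_(i <- s) ga_mul a (F i).
Proof.
by apply: (big_morph (ga_mul a)) => [x y|]; [exact: ga_mulDr|exact: ga_mul0r].
Qed.

Lemma ga_mulUU (x y : R[i]) (g h : G) :
  ga_mul << x *g g >> << y *g h >> = << x * y *g (g * h)%g >>.
Proof.
by rewrite (ga_mulw msuppU_le msuppU_le) !big_seq_fset1 !mcoeffUU.
Qed.

Lemma ga_decomp a : a = \sum_(g <- msupp a) (<< a@_g *g g >> : A).
Proof. exact: monalgE. Qed.

Lemma ga_ind (P : A -> Prop) : (forall x g, P << x *g g >>) -> P 0 ->
  (forall a b, P a -> P b -> P (a + b)) -> forall a, P a.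
Proof.
move=> PU P0 PD a; rewrite (ga_decomp a).
by elim/big_ind: _ => // g _; exact: PU.
Qed.

Fact ga_mulA : associative ga_mul.
Proof.
move=> a b c; elim/ga_ind: a => [x g||a a' IH IH'].
- elim/ga_ind: b => [y h||b b' IH IH'].
  + elim/ga_ind: c => [z k||c c' IH IH'].
    * by rewrite !ga_mulUU mulrA mulgA.
    * by rewrite !ga_mul0r.
    * by rewrite !ga_mulDr IH IH'.
  + by rewrite ga_mul0l ga_mul0r ga_mul0l.
  + by rewrite ga_mulDl !ga_mulDr ga_mulDl IH IH'.
- by rewrite !ga_mul0l.
- by rewrite !ga_mulDl IH IH'.
Qed.

Fact ga_mul1l : left_id ga_one ga_mul.
Proof.
elim/ga_ind => [x g||a b IH IH'].
- by rewrite ga_mulUU mul1r mul1g.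
- by rewrite ga_mul0r.
- by rewrite ga_mulDr IH IH'.
Qed.

Fact ga_mul1r : right_id ga_one ga_mul.
Proof.
elim/ga_ind => [x g||a b IH IH'].
- by rewrite ga_mulUU mulr1 mulg1.
- by rewrite ga_mul0l.
- by rewrite ga_mulDl IH IH'.
Qed.

Fact ga_one_neq0 : ga_one != 0.
Proof.
apply/eqP => /(congr1 (fun a : A => a@_1%g)) /eqP.
by rewrite mcoeffUU mcoeff0 oner_eq0.
Qed.

HB.instance Definition _ := GRing.Zmodule_isNzRing.Build A
  ga_mulA ga_mul1l ga_mul1r ga_mulDl ga_mulDr ga_one_neq0.

Lemma ga_scaleU (s x : R[i]) (g : G) : s *: (<< x *g g >> : A) = << s * x *g g >>.
Proof. by apply/malgP => k; rewrite mcoeffZ !mcoeffU mulrnAr. Qed.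

Fact ga_scaleAl (s : R[i]) a b : s *: (a * b) = s *: a * b.
Proof.
elim/ga_ind: a => [x g||a a' IH IH'].
- elim/ga_ind: b => [y h||b b' IH IH'].
  + by rewrite ga_scaleU /GRing.mul /= !ga_mulUU ga_scaleU mulrA.
  + by rewrite !mulr0 scaler0.
  + by rewrite !mulrDr scalerDr IH IH'.
- by rewrite scaler0 !mul0r scaler0.
- by rewrite mulrDl !scalerDr mulrDl IH IH'.
Qed.

HB.instance Definition _ := GRing.Lmodule_isLalgebra.Build R[i] A ga_scaleAl.

End GroupAlgebra.

Section Representations.
Variables (R : realType) (G : groupType).
Local Notation A := (group_algebra R G).

(* Each pi g is invertible, with inverse pi (g^-1). *)
Record representation (E : completeNormedModType R[i]) := Representation {
  rep_op :> G -> boundedOp E E;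
  rep1 : rep_op 1%g = idop E;
  repM : forall g h, rep_op (g * h)%g = compop (rep_op g) (rep_op h) }.

Definition rep_alg (E : completeNormedModType R[i]) (pi : representation E)
  (a : A) : boundedOp E E := \sum_(g <- msupp a) a@_g *: pi g.

Section RepAlg.
Variables (E : completeNormedModType R[i]) (pi : representation E).

Lemma rep_algw (d : {fset G}) (a : A) : (msupp a `<=` d)%fset ->
  rep_alg pi a = \sum_(g <- d) a@_g *: pi g.
Proof.
move=> le; rewrite /rep_alg (big_fset_incl _ le) //= => g _ /mcoeff_outdom ->.
by rewrite scale0r.
Qed.

Lemma rep_algD (a b : A) : rep_alg pi (a + b) = rep_alg pi a + rep_alg pi b.
Proof.
pose d := (msupp a `|` msupp b)%fset.
rewrite !(@rep_algw d) ?fsubsetUl ?fsubsetUr ?msuppD_le // -big_split /=.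
by apply: eq_bigr => g _; rewrite mcoeffD scalerDl.
Qed.

Lemma rep_algZ (s : R[i]) (a : A) : rep_alg pi (s *: a) = s *: rep_alg pi a.
Proof.
rewrite (@rep_algw (msupp a)) ?msuppZ_le // scaler_sumr.
by apply: eq_bigr => g _; rewrite mcoeffZ scalerA.
Qed.

Lemma rep_alg0 : rep_alg pi 0 = 0.
Proof. by rewrite -(scale0r (0 : A)) rep_algZ scale0r. Qed.

Lemma rep_algU (x : R[i]) (g : G) : rep_alg pi << x *g g >> = x *: pi g.
Proof. by rewrite (rep_algw msuppU_le) big_seq_fset1 mcoeffUU. Qed.

Lemma rep_algM (a b : A) :
  rep_alg pi (a * b) = compop (rep_alg pi a) (rep_alg pi b).
Proof.
elim/ga_ind: a => [x g||a a' IH IH'].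
- elim/ga_ind: b => [y h||b b' IH IH'].
  + rewrite [_ * _]ga_mulUU !rep_algU repM; apply: bop_ext => v.
    by rewrite bopZ !compopE !bopZ bop_scale scalerA.
  + rewrite mulr0 rep_alg0; apply: bop_ext => v.
    by rewrite compopE -[in RHS](scale0r (0 : boundedOp E E)) bopZ scale0r bop0.
  + rewrite mulrDr !rep_algD IH IH'; apply: bop_ext => v.
    by rewrite compopE !bopD !compopE bop_add.
- by rewrite mul0r rep_alg0; apply: bop_ext.
- by rewrite mulrDl !rep_algD IH IH'; apply: bop_ext.
Qed.

End RepAlg.

(* A collection F of representations for which sup_F |pi g| is finite for every
   g, so that |a|_F = sup_F |pi a| is a seminorm on C[G]. *)
Record rep_collection := RepCollection {
  rc_mem :> forall E, representation E -> Prop;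
  rcP : forall g, exists M, forall E (pi : representation E),
    rc_mem pi -> rnorm (pi g) <= M }.

Section Collection.
Variable F : rep_collection.

Definition coll_norm (a : A) : R :=
  sup [set r | exists E (pi : representation E),
                 F E pi /\ r = rnorm (rep_alg pi a)].

Lemma coll_bounded (a : A) : exists M, forall E (pi : representation E),
  F E pi -> rnorm (rep_alg pi a) <= M.
Proof.
elim/ga_ind: a => [x g||a b [M hM] [K hK]].
- have [M hM] := rcP F g; exists (rnorm x * M) => E pi Fpi.
  by rewrite rep_algU rnormZ ler_wpM2l ?rnorm_ge0 // hM.
- by exists 0 => E pi _; rewrite rep_alg0 rnorm0.
- exists (M + K) => E pi Fpi; rewrite rep_algD (le_trans (rnormD _ _)) //.
  by rewrite lerD ?hM ?hK.
Qed.

Lemma coll_norm_ge E (pi : representation E) a :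
  F E pi -> rnorm (rep_alg pi a) <= coll_norm a.
Proof.
move=> Fpi; have [M hM] := coll_bounded a.
apply: ub_le_sup; last by exists E, pi.
by exists M => _ [E' [pi' [Fpi' ->]]]; exact: hM.
Qed.

Lemma coll_norm_le a M : 0 <= M ->
  (forall E (pi : representation E), F E pi -> rnorm (rep_alg pi a) <= M) ->
  coll_norm a <= M.
Proof.
move=> M0 hM; rewrite /coll_norm; set S := [set r | _].
have [->|/set0P S0] := eqVneq S set0; first by rewrite sup0.
by apply: ge_sup => // _ [E [pi [Fpi ->]]]; exact: hM.
Qed.

Lemma coll_norm_ge0 a : 0 <= coll_norm a.
Proof.
rewrite /coll_norm; set S := [set r | _].
have [->|/set0P [_ [E [pi [Fpi _]]]]] := eqVneq S set0; first by rewrite sup0.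
exact: le_trans (rnorm_ge0 _) (coll_norm_ge a Fpi).
Qed.

Fact coll_normD a b : coll_norm (a + b) <= coll_norm a + coll_norm b.
Proof.
apply: coll_norm_le => [|E pi Fpi]; first by rewrite addr_ge0 ?coll_norm_ge0.
by rewrite rep_algD (le_trans (rnormD _ _)) // lerD // coll_norm_ge.
Qed.

Lemma coll_normZ_le (s : R[i]) a : coll_norm (s *: a) <= rnorm s * coll_norm a.
Proof.
apply: coll_norm_le => [|E pi Fpi].
  by rewrite mulr_ge0 ?rnorm_ge0 ?coll_norm_ge0.
by rewrite rep_algZ rnormZ ler_wpM2l ?rnorm_ge0 // coll_norm_ge.
Qed.

Fact coll_normZ (s : R[i]) a : coll_norm (s *: a) = rnorm s * coll_norm a.
Proof.
apply/eqP; rewrite eq_le coll_normZ_le /=.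
have [->|s0] := eqVneq s 0; first by rewrite rnorm0 mul0r coll_norm_ge0.
have sgt0 : 0 < rnorm s.
  by rewrite lt_neqAle rnorm_ge0 andbT eq_sym; apply: contra s0 => /eqP/rnorm0_eq0/eqP.
have := coll_normZ_le s^-1 (s *: a); rewrite scalerA mulVf // scale1r.
rewrite -(ler_pM2l sgt0) => h; apply: le_trans h _.
by rewrite mulrA -rnormM mulfV // rnorm1 mul1r.
Qed.

Fact coll_normM a b : coll_norm (a * b) <= coll_norm a * coll_norm b.
Proof.
apply: coll_norm_le => [|E pi Fpi]; first by rewrite mulr_ge0 ?coll_norm_ge0.
rewrite rep_algM; apply: le_trans (opnorm_comp _ _) _.
by apply: ler_pM; rewrite ?opnorm_ge0 // -rnorm_opE coll_norm_ge.
Qed.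

Definition coll_seminorm : algebra_seminorm A :=
  AlgebraSeminorm (asn := Seminorm coll_normD coll_normZ) coll_normM.

Definition coll_completion := completion coll_seminorm.

(* The extension to the completion C_F(G) of pi : C[G] -> B(E): completion_seq a is a Cauchy
   sequence of C[G] converging to a in C_F(G), see completion_seq_cvg.  The
   limit exists by rep_ext_cvg and extends rep_alg pi by
   rep_ext_to_completion. *)
Definition rep_ext E (pi : representation E) (a : coll_completion) :
    boundedOp E E :=
  lim (rep_alg pi (completion_seq a n) @[n --> \oo]).

Lemma rep_algB E (pi : representation E) (a b : A) :
  rep_alg pi (a - b) = rep_alg pi a - rep_alg pi b.
Proof. by rewrite rep_algD -(scaleN1r b) rep_algZ scaleN1r. Qed.

Lemma rep_ext_cvg E (pi : representation E) (a : coll_completion) : F E pi ->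
  rep_alg pi (completion_seq a n) @[n --> \oo] --> rep_ext pi a.
Proof.
move=> Fpi; pose u n := rep_alg pi (completion_seq a n).
have [|l hl] := @banach_complete _ _ u.
  move=> e /(csP (completion_seq a)) [N hN]; exists N => m n Nm Nn.
  by rewrite /= -rep_algB (le_trans (coll_norm_ge _ Fpi)) //; exact: hN.
by apply/cvg_ex; exists l; apply/sn_cvgP.
Qed.

Lemma rep_ext_to_completion E (pi : representation E) (a : A) : F E pi ->
  rep_ext pi (to_completion coll_seminorm a) = rep_alg pi a.
Proof.
move=> Fpi; apply/cvg_lim; first exact: norm_hausdorff.
apply/sn_cvgP => e e0; set x := to_completion _ a.
have /sn_cvgP /(_ e e0) [N hN] := @completion_seq_cvg _ _ coll_seminorm x.
exists N => n /hN /= h; rewrite -rep_algB (le_trans (coll_norm_ge _ Fpi)) //.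
by rewrite -[coll_norm _](rnorm_to_completion coll_seminorm) to_completionB.
Qed.

End Collection.

End Representations.

Section BanachSpaces.
Variable R : realType.
Local Notation C := R[i].
Local Notation banach := (completeNormedModType C).

Definition isometric (X Y : normedModType C) : Prop :=
  exists f : {linear X -> Y},
    (forall x, `|f x| = `|x|) /\ range f = [set: Y].

Definition dual (X : normedModType C) := boundedOp X C^o.

(* The canonical map x |-> (f |-> f x) from X to its bidual is onto. *)
Definition reflexive_space (X : banach) : Prop :=
  forall phi : dual (dual X), exists x : X, forall f : dual X, phi f = f x.

Definition span (Y : lmodType C) (n : nat) (v : 'I_n -> Y) : set Y :=
  range (fun a : 'I_n -> C => \sum_(k < n) a k *: v k).

(* Every finite-dimensional subspace span v of Y embeds (1 + e)-isomorphically in X,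
   for every e > 0.  Only the restriction of T to span v matters. *)
Definition finitely_representable (Y X : banach) : Prop :=
  forall (n : nat) (v : 'I_n -> Y) (e : R), 0 < e ->
  exists T : Y -> X,
    (forall (a : C) (x y : Y), span v x -> span v y ->
       T (a *: x + y) = a *: T x + T y) /\
    (forall x, span v x ->
       rnorm x <= rnorm (T x) /\ rnorm (T x) <= (1 + e) * rnorm x).

Definition superreflexive (X : banach) : Prop :=
  forall Y : banach, finitely_representable Y X -> reflexive_space Y.

(* A class of Banach spaces need not be closed under isometries, so an
   ultraproduct is only required to be isometric to a member. *)
Definition stable_by_ultraproducts (cE : banach -> Prop) : Prop :=
  forall (I : Type) (U : set_system I) (UU : UltraFilter U) (X : I -> banach),
    (forall k, cE (X k)) ->
    exists Y, cE Y /\ isometric (ultraproduct UU X) Y.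

End BanachSpaces.

Section FixedPoints.
Variables (R : realType) (G : groupType).

Record affine_isometric_action (E : completeNormedModType R[i]) := AffineAction {
  aff_act :> G -> E -> E;
  aff_act1 : forall x, aff_act 1%g x = x;
  aff_actM : forall g h x, aff_act (g * h)%g x = aff_act g (aff_act h x);
  aff_act_affine : forall g, exists (L : {linear E -> E}) (b : E),
    forall x, aff_act g x = L x + b;
  aff_act_isometric : forall g x y,
    `|aff_act g x - aff_act g y| = `|x - y| }.

Definition fixed_point_property (cE : completeNormedModType R[i] -> Prop) :
    Prop :=
  forall E, cE E -> forall alpha : affine_isometric_action E,
  exists x, forall g, alpha g x = x.

End FixedPoints.

Section WordLength.
Variable G : groupType.

(* Finite symmetric generating sets containing the identity.  A group is finitely
   generated exactly when it has one. *)
Record generating_set := GeneratingSet {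
  gs_set :> set G;
  gs_finite : finite_set gs_set;
  gs1 : gs_set 1%g;
  gsV : forall g, gs_set g -> gs_set g^-1%g;
  gs_generates : forall H : set G, H 1%g ->
    (forall g h, H g -> H h -> H (g * h)%g) ->
    (forall g, H g -> H g^-1%g) -> gs_set `<=` H -> H = [set: G] }.

Fixpoint set_pow (A : set G) (n : nat) : set G :=
  if n is m.+1 then [set (x * y)%g | x in A & y in set_pow A m] else [set 1%g].

Variable S : generating_set.

Lemma set_powD m n g h :
  set_pow S m g -> set_pow S n h -> set_pow S (m + n) (g * h)%g.
Proof.
elim: m g => [|m IH] g /=; first by move=> ->; rewrite mul1g.
move=> [x Sx [y Sy <-]] Sh; exists x => //; exists (y * h)%g; first exact: IH.
by rewrite mulgA.
Qed.

Lemma set_powV n g : set_pow S n g -> set_pow S n g^-1%g.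
Proof.
elim: n g => [|n IH] g /=; first by move=> ->; rewrite invg1.
move=> [x Sx [y Sy <-]]; rewrite invgM.
suff : set_pow S (n + 1) (y^-1 * x^-1)%g by rewrite addn1.
apply: set_powD; first exact: IH.
by exists x^-1%g; [exact: gsV|exists 1%g; rewrite ?mulg1].
Qed.

Lemma set_pow_ex g : exists n, `[< set_pow S n g >].
Proof.
pose H : set G := [set g | exists n, set_pow S n g].
suff : H g by move=> [n Sn]; exists n; apply/asboolP.
suff -> : H = [set: G] by [].
apply: gs_generates.
- by exists 0%N.
- by move=> x y [m hm] [n hn]; exists (m + n)%N; exact: set_powD.
- by move=> x [n hn]; exists n; exact: set_powV.
- move=> x Sx; exists 1%N; exists x; first exact: Sx.
  by exists 1%g; rewrite ?mulg1.
Qed.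

Definition word_length (g : G) : nat := ex_minn (set_pow_ex g).

End WordLength.

Section Kazhdan.
Variables (R : realType) (G : groupType).
Local Notation A := (group_algebra R G).

Definition invariants (E : completeNormedModType R[i])
  (pi : representation G E) : set E := [set x | forall g, pi g x = x].

Definition projection_onto (E : completeNormedModType R[i])
  (T : boundedOp E E) (V : set E) : Prop := compop T T = T /\ range T = V.

Definition kazhdan_projection (F : rep_collection R G) (p : coll_completion F) :
    Prop :=
  [/\ p * p = p,
      closure [set to_completion (coll_seminorm F) m | m in
                 [set m : A | \sum_(g <- msupp m) m@_g = 1]] p
    & forall E (pi : representation G E), F E pi ->
        projection_onto (rep_ext pi p) (invariants pi)].

Variables (cE : completeNormedModType R[i] -> Prop) (S : generating_set G).

(* Membership in F(cE, c l), for the word length l of S. *)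
Definition small_growth (c : R) (E : completeNormedModType R[i])
    (pi : representation G E) : Prop :=
  (exists E0, cE E0 /\ isometric E E0) /\
  forall g, rnorm (pi g) <= expR (c * (word_length S g)%:R).

Fact small_growth_bounded c g : exists M, forall E (pi : representation G E),
  small_growth c pi -> rnorm (pi g) <= M.
Proof. by exists (expR (c * (word_length S g)%:R)) => E pi [_]. Qed.

Definition small_growth_collection (c : R) : rep_collection R G :=
  RepCollection (small_growth_bounded c).

(* Changing S only rescales c, so this property does not depend on S. *)
Definition robust_property_T : Prop :=
  exists2 c : R, 0 < c &
    exists p : coll_completion (small_growth_collection c),
      kazhdan_projection p.

End Kazhdan.

(* Main.v *)
(** Write [disp pi x] for the sum of [|pi s x - x|] over the generators [s].  A
   Kazhdan projection exists as soon as some [m] of total mass 1 satisfies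
   [disp (pi m x) <= disp x / 2] uniformly in the collection: the powers of [m]
   are then Cauchy in C_F(G), and their limit projects onto the invariant
   vectors.  Such an [m] and such a rate [c] come from two ultraproduct arguments.

   First, every [x] is an invariant vector plus a vector of norm at most
   [C * disp x].  A sequence of counterexamples with [c -> 0] and [disp = 1] has
   coboundaries [pi_k g x_k - x_k] bounded for each [g]; they form a cocycle for
   the isometric limit representation on the ultraproduct, whose affine action
   has a fixed point, that is, a bounded correction killing most of [disp x_k].
   Iterating such corrections gives an exact decomposition.

   Second, let [T] be the average of the generators and [m_N] the Cesaro mean of
   [1, T, .., T^(N-1)].  If no [m_N] contracted [disp], one would get bounded
   vectors [z_N = m_N y_N] with [disp z_N > 1/2] although
   [T z_N - z_N = (T^N y_N - y_N) / N] tends to 0; their class in the ultraproduct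
   is a [T]-fixed vector of an isometric representation on a reflexive space.  Such
   a vector is invariant.  Otherwise its orbit has no small slice, because a slice
   very near the maximum of a functional contains [g s z] together with [g z].  One
   can then build nested slices of the orbit avoiding in turn the balls around a
   countable set dense in its span, and a weak limit of points of these slices
   is a contradiction. *)
Require Import Defs.
From HB Require Import structures.
From mathcomp Require Import all_boot all_order all_algebra.
From mathcomp Require Import complex.
From mathcomp Require Import finmap.
From mathcomp.multinomials Require Import monalg.
From mathcomp Require Import all_classical all_reals all_analysis.
From mathcomp Require Import ring lra.
Set Implicit Arguments. Unset Strict Implicit. Unset Printing Implicit Defensive.
Import Order.TTheory GRing.Theory Num.Theory numFieldNormedType.Exports.
Local Open Scope classical_set_scope.
Local Open Scope ring_scope.

(** * The Hahn-Banach theorem *)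

Section HahnBanach.
Context {R : realType} {V : lmodType R[i]}.
Implicit Types (p q : V -> R) (l : V -> R).

Definition sublinear q : Prop :=
  (forall x y, q (x + y) <= q x + q y) /\
  (forall r x, 0 <= r -> q (r%:C%C *: x) = r * q x).

Definition real_linear l : Prop :=
  (forall x y, l (x + y) = l x + l y) /\
  (forall r x, l (r%:C%C *: x) = r * l x).

(** The reverse inequality is the hypothesis at [r^-1] and [r%:C%C *: x], so functionals built as
    infima need only one direction. *)
Lemma sublinearI q : (forall x y, q (x + y) <= q x + q y) -> q 0 = 0 ->
  (forall r x, 0 < r -> q (r%:C%C *: x) <= r * q x) -> sublinear q.
Proof.
move=> qD q0 qZ; split=> // r x; rewrite le_eqVlt => /predU1P[<-|r0].
  by rewrite scale0r mul0r.
apply/eqP; rewrite eq_le qZ //=.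
have := qZ r^-1 (r%:C%C *: x); rewrite invr_gt0 => /(_ r0).
by rewrite scalerA -rmorphM mulVf ?gt_eqF // scale1r mulrC ler_pdivlMr // mulrC.
Qed.

Lemma sublinear0 q : sublinear q -> q 0 = 0.
Proof. by move=> [_ qZ]; have := qZ 0 0 (lexx _); rewrite scale0r mul0r. Qed.

Lemma sublinearN q x : sublinear q -> - q (- x) <= q x.
Proof.
move=> qs; have := qs.1 x (- x); rewrite subrr sublinear0 //; lra.
Qed.

(** Take the infimum over [t >= 0] of [q (y + t x) - t q x]. Subadditivity bounds it below, [t = 0]
    gives [q' <= q], and [t = 1] gives the value at [- x]. *)
Lemma sublinear_tilt q x : sublinear q -> exists q',
  [/\ sublinear q', forall y, q' y <= q y & q' (- x) <= - q x].
Proof.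
move=> qs; have [qD qZ] := qs; have q0 := sublinear0 qs.
pose S y := [set q (y + t%:C%C *: x) - t * q x | t in [set t : R | 0 <= t]].
have Slb y : lbound (S y) (- q (- y)).
  move=> _ [t t0 <-]; have := qD (y + t%:C%C *: x) (- y).
  by rewrite [y + _]addrC addrK qZ //; lra.
have Sinf y : has_inf (S y).
  split; last by exists (- q (- y)).
  by exists (q (y + 0%:C%C *: x) - 0 * q x), 0 => //=.
have Sle y t : 0 <= t -> inf (S y) <= q (y + t%:C%C *: x) - t * q x.
  by move=> t0; apply: (ge_inf (Sinf y).2); exists t.
exists (fun y => inf (S y)); split.
- apply: sublinearI => [y z||r y r0].
  + apply/ler_addgt0Pr => e e0; have e20 : 0 < e / 2 by apply: divr_gt0.
    have [_ [s s0 <-] hs] := inf_adherent e20 (Sinf y).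
    have [_ [t t0 <-] ht] := inf_adherent e20 (Sinf z).
    apply: le_trans (Sle (y + z) (s + t) _) _; first exact: addr_ge0.
    rewrite rmorphD scalerDl addrACA.
    have := qD (y + s%:C%C *: x) (z + t%:C%C *: x); lra.
  + apply/eqP; rewrite eq_le; apply/andP; split.
      by have := Sle 0 0 (lexx _); rewrite scale0r addr0 mul0r q0 subr0.
    apply: lb_le_inf (Sinf 0).1 _.
    by have := Slb 0; rewrite oppr0 q0 oppr0.
  + apply/ler_addgt0Pr => e e0; have er0 : 0 < e / r by apply: divr_gt0.
    have [_ [s s0 <-] hs] := inf_adherent er0 (Sinf y).
    apply: le_trans (Sle _ (r * s) _) _; first by rewrite mulr_ge0 // ltW.
    rewrite rmorphM -scalerA -scalerDr qZ ?(ltW r0) // -mulrA -mulrBr.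
    have <- : r * (inf (S y) + e / r) = r * inf (S y) + e.
      by rewrite mulrDr [r * (e / r)]mulrCA mulfV ?gt_eqF // mulr1.
    by rewrite ler_pM2l // ltW.
- by move=> y; have := Sle y 0 (lexx _); rewrite scale0r addr0 mul0r subr0.
- have := Sle (- x) 1 ler01.
  by rewrite scale1r addNr q0 mul1r sub0r.
Qed.

Lemma sublinear_chain p (A : set (V -> R)) : sublinear p ->
  (forall q, A q -> sublinear q /\ (forall x, q x <= p x)) ->
  (forall q q', A q -> A q' ->
     (forall x, q x <= q' x) \/ (forall x, q' x <= q x)) ->
  exists q, [/\ sublinear q, forall x, q x <= p x &
    forall q', A q' -> forall x, q x <= q' x].
Proof.
move=> ps Ap Atot; have [A0|/set0P [q1 Aq1]] := eqVneq A set0.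
  by exists p; split=> // q; rewrite A0.
pose S x := [set q x | q in A].
have Slb x : lbound (S x) (- p (- x)).
  move=> _ [q Aq <-]; have [qs qp] := Ap q Aq.
  by apply: le_trans _ (sublinearN x qs); rewrite lerN2.
have Sinf x : has_inf (S x).
  by split; [exists (q1 x), q1|exists (- p (- x))].
have Sle x q : A q -> inf (S x) <= q x.
  by move=> Aq; apply: (ge_inf (Sinf x).2); exists q.
exists (fun x => inf (S x)); split.
- apply: sublinearI => [x y||r x r0].
  + apply/ler_addgt0Pr => e e0; have e20 : 0 < e / 2 by apply: divr_gt0.
    have [_ [q Aq <-] hq] := inf_adherent e20 (Sinf x).
    have [_ [q' Aq' <-] hq'] := inf_adherent e20 (Sinf y).
    have [h|h] := Atot q q' Aq Aq'.
      have [[qD _] _] := Ap q Aq.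
      by apply: le_trans (Sle _ q Aq) _; have := qD x y; have := h y; lra.
    have [[qD _] _] := Ap q' Aq'.
    by apply: le_trans (Sle _ q' Aq') _; have := qD x y; have := h x; lra.
  + apply/eqP; rewrite eq_le; apply/andP; split.
      by have [qs _] := Ap q1 Aq1; rewrite -(sublinear0 qs); apply: Sle.
    apply: lb_le_inf (Sinf 0).1 _ => _ [q Aq <-].
    by rewrite sublinear0 //; have [] := Ap q Aq.
  + apply/ler_addgt0Pr => e e0; have er0 : 0 < e / r by apply: divr_gt0.
    have [_ [q Aq <-] hq] := inf_adherent er0 (Sinf x).
    apply: le_trans (Sle _ q Aq) _; have [[_ qZ] _] := Ap q Aq.
    rewrite qZ ?(ltW r0) //.
    have <- : r * (inf (S x) + e / r) = r * inf (S x) + e.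
      by rewrite mulrDr [r * (e / r)]mulrCA mulfV ?gt_eqF // mulr1.
    by rewrite ler_pM2l // ltW.
- by move=> x; apply: le_trans (Sle x q1 Aq1) _; have [] := Ap q1 Aq1.
- by move=> q Aq x; exact: Sle.
Qed.

(* A minimal sublinear functional is linear: it equals each of its tilts. *)
Lemma sublinear_above_linear p : sublinear p ->
  exists2 l, real_linear l & forall x, l x <= p x.
Proof.
move=> ps; pose T := {q : V -> R | sublinear q /\ (forall x, q x <= p x)}.
(* The order is reversed, so that a maximal element for [Zorn] is a minimal functional. *)
pose r (s t : T) := `[< forall x, sval t x <= sval s x >].
have [||||[q [qs qp]] /= qmin] := @Zorn T r.
- by move=> t; apply/asboolP.
- move=> t1 t2 t3 /asboolP h1 /asboolP h2; apply/asboolP => x.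
  exact: le_trans (h2 x) (h1 x).
- move=> [q1 P1] [q2 P2] /asboolP /= h1 /asboolP /= h2.
  have E : q1 = q2 by apply/funext => x; apply/eqP; rewrite eq_le h1 h2.
  by case: _ / E in P2 h1 h2 *; congr exist; exact: Prop_irrelevance.
- move=> A Atot; pose B := [set sval t | t in A].
  have [||q [qs qp qA]] := @sublinear_chain p B ps.
  + by move=> _ [[q qP] _ <-].
  + by move=> _ _ [s As <-] [t At <-];
    have [/asboolP|/asboolP] := Atot s t As At; [right|left].
  by exists (exist _ q (conj qs qp)) => t At; apply/asboolP => x /=; apply: qA; exists t.
have qN x : q (- x) = - q x.
  have [q' [qs' qq' hq']] := sublinear_tilt x qs.
  have /= := qmin (exist _ q' (conj qs' (fun y => le_trans (qq' y) (qp y)))).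
  move=> /(_ (introT (asboolP _) qq')) /(congr1 sval) /= E; rewrite {}E in hq'.
  apply/eqP; rewrite eq_le hq' /=.
  by have := sublinearN (- x) qs; rewrite opprK.
have [qD qZ] := qs; exists q => //; split=> [x y|a x].
  apply/eqP; rewrite eq_le qD /=.
  by have := qD (x + y) (- y); rewrite addrK qN; lra.
have [a0|/ltW a0] := leP 0 a; first exact: qZ.
rewrite -[a]opprK rmorphN scaleNr qN qZ ?oppr_ge0 //; lra.
Qed.

(** Tilting [p] at [x0] first forces [l (- x0) <= - p x0] for every linear [l] below the tilt. *)
Lemma hahn_banach p x0 : sublinear p ->
  exists l, [/\ real_linear l, forall x, l x <= p x & l x0 = p x0].
Proof.
move=> ps; have [q [qs qp qx]] := sublinear_tilt x0 ps.
have [l ll lq] := sublinear_above_linear qs.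
have lp x : l x <= p x by apply: le_trans (lq x) (qp x).
exists l; split=> //; apply/eqP; rewrite eq_le lp /=.
have := lq (- x0); have := ll.1 x0 (- x0); rewrite subrr.
have := ll.2 0 0; rewrite scale0r mul0r; lra.
Qed.

End HahnBanach.

(** * Functionals and weak limits *)

Section WeakLimits.
Context {R : realType}.

Lemma real_linearN (V : lmodType R[i]) (l : V -> R) x :
  real_linear l -> l (- x) = - l x.
Proof.
move=> [lD lZ]; have := lD x (- x); rewrite subrr.
have := lZ 0 0; rewrite scale0r mul0r; lra.
Qed.

Lemma bop_sub (X Y : normedModType R[i]) (f : boundedOp X Y) x y :
  f (x - y) = f x - f y.
Proof. by rewrite bop_add -[- y]scaleN1r bop_scale scaleN1r. Qed.

Lemma Re_dualD (X : normedModType R[i]) (f : dual X) x y :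
  complex.Re (f (x + y)) = complex.Re (f x) + complex.Re (f y).
Proof. by rewrite bop_add raddfD. Qed.

Lemma Re_dualZ (X : normedModType R[i]) (f : dual X) (r : R) x :
  complex.Re (f (r%:C%C *: x)) = r * complex.Re (f x).
Proof. by rewrite bop_scale; case: (f x) => a b /=; rewrite mul0r subr0. Qed.

Lemma Re_dualB (X : normedModType R[i]) (f : dual X) x y :
  complex.Re (f (x - y)) = complex.Re (f x) - complex.Re (f y).
Proof. by rewrite bop_sub raddfB. Qed.

Lemma Re_dualN (X : normedModType R[i]) (f : dual X) x :
  complex.Re ((- f) x) = - complex.Re (f x).
Proof. by rewrite -raddfN. Qed.

Lemma Re_le_rnorm (z : R[i]) : complex.Re z <= rnorm z.
Proof.
case: z => a b; rewrite /rnorm normc_def /=.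
apply: le_trans (ler_norm a) _; rewrite -sqrtr_sqr ler_wsqrtr //.
by rewrite lerDl sqr_ge0.
Qed.

Lemma Re_dual_le (X : normedModType R[i]) (f : dual X) x :
  complex.Re (f x) <= opnorm f * rnorm x.
Proof. exact: le_trans (Re_le_rnorm _) (opnormP f x). Qed.

Lemma rnormi : rnorm ('i%C : R[i]) = 1.
Proof. by rewrite /rnorm normc_def /= expr0n expr1n add0r sqrtr1. Qed.

Lemma rnorm_complex (z : R[i]) :
  rnorm z <= `|complex.Re z| + `|complex.Im z|.
Proof.
rewrite {1}[z]complexE; apply: le_trans (rnormD _ _) _.
by rewrite rnormM rnormi mul1r !rnormR.
Qed.

(** The usual complexification [l x - i l (i x)]. *)
Lemma dual_of_real (X : normedModType R[i]) (l : X -> R) (M : R) :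
  real_linear l -> (forall x, l x <= M * rnorm x) ->
  exists f : dual X, forall x, complex.Re (f x) = l x.
Proof.
move=> ll lM; have [lD lZ] := ll.
have lM' x : `|l x| <= M * rnorm x.
  by rewrite ler_norml lerNl -real_linearN // -[rnorm x]rnormN lM rnormN lM.
pose f x : R[i]^o := (l x +i* - l ('i%C *: x))%C.
have fP : f \in bounded_op.
  rewrite inE; split=> [[a b] x y|].
    rewrite /f; apply/eqP; rewrite eq_complex /= scalerDr !lD.
    have aE : (a +i* b)%C = a%:C%C + 'i%C * b%:C%C by rewrite [LHS]complexE.
    have iaE : 'i%C * (a +i* b)%C = a%:C%C * 'i%C - b%:C%C.
      by rewrite aE mulrDr mulrA -expr2 sqr_i mulN1r [_ * a%:C%C]mulrC.
    rewrite scalerA iaE scalerBl -scalerA lD real_linearN // !lZ.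
    rewrite aE scalerDl [in X in l (_ + X)]mulrC -scalerA lD !lZ.
    by apply/andP; split; apply/eqP; ring.
  exists (M + M) => x; apply: le_trans (rnorm_complex (f x)) _.
  rewrite normrN mulrDl lerD //; first exact: lM'.
  by have := lM' ('i%C *: x); rewrite rnormZ rnormi mul1r.
by exists (BoundedOp fP).
Qed.

Lemma norming_functional (X : normedModType R[i]) (x : X) :
  exists f : dual X, (forall y, complex.Re (f y) <= rnorm y) /\
    complex.Re (f x) = rnorm x.
Proof.
have [|l [ll lp lx]] := @hahn_banach _ _ (fun y : X => rnorm y) x.
  split=> [y z|r y r0]; first exact: rnormD.
  by rewrite rnormZ rnormR ger0_norm.
have [y|f hf] := @dual_of_real X l 1 ll; first by rewrite mul1r.
by exists f; split=> [y|]; rewrite hf.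
Qed.

Lemma ultra_bounded_cvg (I : Type) (U : set_system I) (UU : UltraFilter U)
  (f : I -> R) (M : R) : (forall i, `|f i| <= M) -> cvg (f i @[i --> U]).
Proof.
move=> fM.
have [|l hl] := (cvg_ex _).1 (@ultra_cvg R I U UU (fun i => f i + M) (M + M) _).
  by move=> i; have := fM i; rewrite ler_norml => /andP[? ?]; apply/andP; split; lra.
apply/cvg_ex; exists (l - M).
rewrite [X in X @ _](_ : _ = (fun i => (f i + M) - M)); last first.
  by apply/funext => i; rewrite addrK.
by apply: cvgB => //; exact: cvg_cst.
Qed.

(* [x] represents the bidual element [f |-> lim f (u n)], the limit being taken
   along an ultrafilter. *)
Lemma reflexive_weak_limit (X : completeNormedModType R[i]) (u : nat -> X) M :
  reflexive_space X -> (forall n, rnorm (u n) <= M) ->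
  exists x, forall (f : dual X) a,
    (exists N, forall n, (N <= n)%N -> a <= complex.Re (f (u n))) ->
    a <= complex.Re (f x).
Proof.
move=> Xr uM; have [U [UU NU]] := @ultraFilterLemma nat \oo _.
have M0 : 0 <= M by apply: le_trans (uM 0%N); exact: rnorm_ge0.
have fu (f : dual X) n : `|complex.Re (f (u n))| <= M * opnorm f.
  have le g : complex.Re (bop_fun (g : dual X) (u n)) <= M * opnorm g.
    apply: le_trans (Re_dual_le _ _) _.
    by rewrite mulrC ler_wpM2r ?opnorm_ge0.
  rewrite ler_norml le andbT lerNl.
  have := le (- f); rewrite -[opnorm (- f)]rnorm_opE rnormN.
  by rewrite Re_dualN.
pose l (f : dual X) := lim (complex.Re (f (u n)) @[n --> U]).
have lcvg (f : dual X) : complex.Re (f (u n)) @[n --> U] --> l f.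
  exact: (ultra_bounded_cvg UU (fu f)).
have ll : real_linear l.
  split=> [f g|r f]; apply/cvg_lim => //.
    under eq_fun do rewrite bopD raddfD.
    by apply: cvgD; exact: lcvg.
  rewrite [X in X @ _](_ : _ = fun n => r * complex.Re (f (u n))).
    by apply: cvgMr; exact: lcvg.
  by apply/funext => n; rewrite bopZ; case: (f _) => a b /=; rewrite mul0r subr0.
have lM f : l f <= M * rnorm f.
  apply: limr_le; first by apply/cvg_ex; exists (l f); exact: lcvg.
  by apply: filterE => n; apply: le_trans (ler_norm _) (fu f n).
(* [l] is only real-linear on the dual; its complexification is an element of the bidual, to which
   reflexivity applies. *)
have [phi hphi] := dual_of_real ll lM.
have [x hx] := Xr phi; exists x => f a [N hN].
rewrite -hx hphi; apply: limr_ge; first by apply/cvg_ex; exists (l f); exact: lcvg.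
by apply: NU; exists N.
Qed.

End WeakLimits.

(** * Harmonic orbits in reflexive spaces *)

Section Harmonic.
Context {R : realType} {X : completeNormedModType R[i]}.

(** Lists over [rat * nat] form a countable type, which lets the combinations be enumerated. *)
Definition rat_comb (v : nat -> X) (s : seq (rat * nat)) : X :=
  \sum_(c <- s) (ratr c.1 : R)%:C%C *: v c.2.

Lemma rat_comb_cat v s t : rat_comb v (s ++ t) = rat_comb v s + rat_comb v t.
Proof. by rewrite /rat_comb big_cat. Qed.

Lemma rat_combZ v q s :
  (ratr q : R)%:C%C *: rat_comb v s = rat_comb v [seq (q * c.1, c.2) | c <- s].
Proof.
rewrite /rat_comb big_map scaler_sumr; apply: eq_bigr => c _ /=.
by rewrite scalerA -!rmorphM.
Qed.

(** The distance to the rational combinations is sublinear. A linear functional below it that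
    attains it at [x] is at most 0 on every [v n], hence at [x], so this distance vanishes. *)
Lemma rat_comb_dense (v : nat -> X) (x : X) :
  (forall f : dual X, (forall n, complex.Re (f (v n)) <= 0) ->
     complex.Re (f x) <= 0) ->
  forall e, 0 < e -> exists s, rnorm (x - rat_comb v s) <= e.
Proof.
move=> vx; pose S y := [set rnorm (y - rat_comb v s) | s in [set: seq (rat * nat)]].
have Slb y : lbound (S y) 0 by move=> _ [s _ <-]; exact: rnorm_ge0.
have Sinf y : has_inf (S y).
  by split; [exists (rnorm (y - rat_comb v [::])), [::]|exists 0].
have Sle y s : inf (S y) <= rnorm (y - rat_comb v s).
  by apply: (ge_inf (Sinf y).2); exists s.
have ps : sublinear (fun y => inf (S y)).
  apply: sublinearI => [y z||r y r0].
  - apply/ler_addgt0Pr => e e0; have e20 : 0 < e / 2 by apply: divr_gt0.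
    have [_ [s _ <-] hs] := inf_adherent e20 (Sinf y).
    have [_ [t _ <-] ht] := inf_adherent e20 (Sinf z).
    apply: le_trans (Sle _ (s ++ t)) _; rewrite rat_comb_cat opprD addrACA.
    by have := rnormD (y - rat_comb v s) (z - rat_comb v t); lra.
  - apply/eqP; rewrite eq_le (lb_le_inf (Sinf 0).1 (Slb 0)) andbT.
    by have := Sle 0 [::]; rewrite /rat_comb big_nil subr0 rnorm0.
  - apply/ler_addgt0Pr => e e0; have er0 : 0 < e / (2 * r).
      by apply: divr_gt0 => //; apply: mulr_gt0.
    have [_ [s _ <-] hs] := inf_adherent er0 (Sinf y).
    set c := rat_comb v s in hs *; have c0 := rnorm_ge0 c.
    (* Only rational multiples of [c] are available: [r] is replaced by a rational less than this
       amount above it, at a cost of at most [e / 2]. *)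
    have d0 : 0 < e / (2 * (rnorm c + 1)).
      by apply: divr_gt0 => //; apply: mulr_gt0 => //; lra.
    set d := e / _ in d0; have dE : d * (rnorm c + 1) = e / 2.
      by rewrite /d; field; rewrite gt_eqF //; lra.
    have rlt : r < r + d by rewrite ltrDl.
    have [q] := rat_in_itvoo rlt; rewrite in_itv /= => /andP[q1 q2].
    apply: le_trans (Sle _ [seq (q * z.1, z.2) | z <- s]) _.
    rewrite -rat_combZ -/c.
    have -> : r%:C%C *: y - (ratr q)%:C%C *: c =
        r%:C%C *: (y - c) + (r - ratr q)%:C%C *: c.
      by rewrite rmorphB scalerBl scalerBr addrA subrK.
    apply: le_trans (rnormD _ _) _.
    rewrite !rnormZ !rnormR gtr0_norm // ltr0_norm ?subr_lt0 // opprB.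
    have h1 : (ratr q - r) * rnorm c <= d * rnorm c by rewrite ler_wpM2r //; lra.
    have h2 : r * rnorm (y - c) <= r * (inf (S y) + e / (2 * r)).
      by rewrite ler_pM2l // ltW.
    have h3 : r * (e / (2 * r)) = e / 2 by field; rewrite gt_eqF.
    by move: h2; rewrite mulrDr h3; move: dE; rewrite mulrDr mulr1; lra.
have [l [ll lp lx]] := hahn_banach x ps.
have [y|f hf] := @dual_of_real R X l 1 ll.
  by apply: le_trans (lp y) _; have := Sle y [::]; rewrite /rat_comb big_nil subr0 mul1r.
have px : inf (S x) <= 0.
  rewrite -lx -hf; apply: vx => n; rewrite hf; apply: le_trans (lp _) _.
  have := Sle (v n) [:: (1, n)].
  by rewrite /rat_comb big_seq1 rmorph1 scale1r subrr rnorm0.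
move=> e e0; have [_ [s _ <-] hs] := inf_adherent e0 (Sinf x).
by exists s; lra.
Qed.

(** * Slices of a bounded harmonic orbit *)

Context {G : groupType} (o : G -> X) (M : R) (S : seq G).
Hypothesis oM : forall g, rnorm (o g) <= M.
Hypothesis o_harmonic : forall g,
  \sum_(s <- S) o (g * s)%g = (size S)%:R *: o g.

Lemma Re_dual_sum (f : dual X) (I : Type) (r : seq I) (F : I -> X) :
  complex.Re (f (\sum_(j <- r) F j)) = \sum_(j <- r) complex.Re (f (F j)).
Proof.
apply: (big_morph (fun x => complex.Re (f x))); first exact: Re_dualD.
by rewrite bop0.
Qed.

(** By harmonicity the defects [B - Re f] at the neighbours [g * t] add up to [size S] times the
    defect at [g]. They are nonnegative, so each is at most their sum. *)
Lemma harmonic_near_max (f : dual X) B g s b : s \in S ->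
  (forall h, complex.Re (f (o h)) <= B) ->
  (size S)%:R * (B - complex.Re (f (o g))) <= b ->
  B - b <= complex.Re (f (o (g * s)%g)).
Proof.
move=> sS fB gb.
have E : \sum_(t <- S) (B - complex.Re (f (o (g * t)%g))) =
    (size S)%:R * (B - complex.Re (f (o g))).
  rewrite big_split /= sumrN -Re_dual_sum o_harmonic big_const_seq count_predT.
  rewrite iter_addr_0 -(rmorph_nat (real_complex R)) Re_dualZ.
  by rewrite mulrBr [_ * B]mulr_natl.
move: gb; rewrite -E (big_rem s) //= => gb.
have : 0 <= \sum_(t <- rem s S) (B - complex.Re (f (o (g * t)%g))).
  by apply: sumr_ge0 => t _; rewrite subr_ge0.
lra.
Qed.

Definition slice_nonempty (f : dual X) (a : R) := exists g, a < complex.Re (f (o g)).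

(** The closed convex hull of the orbit, as an intersection of half-spaces: the form in which a weak
    limit is seen to belong to it. *)
Definition weak_hull (x : X) := forall (f : dual X) c,
  (forall g, complex.Re (f (o g)) <= c) -> complex.Re (f x) <= c.

(* The slice is cut by [k + t f], with [k] norming [o h - e] for a point [o h] of
   the old slice far from [e], and [t] so large that the old slice is not left. *)
Lemma slice_avoiding_ball (s : G) (n : R) (f : dual X) (a : R) (e : X) :
  s \in S -> 0 < n -> (forall g, 4 * n <= rnorm (o (g * s)%g - o g)) ->
  slice_nonempty f a ->
  exists (f' : dual X) a', [/\ slice_nonempty f' a',
    forall g, a' <= complex.Re (f' (o g)) -> a <= complex.Re (f (o g)) &
    forall x, weak_hull x -> rnorm (x - e) <= n -> complex.Re (f' x) < a'].
Proof.
move=> sS n0 sep [g1 ag1].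
have M0 : 0 <= M by apply: le_trans (oM g1); exact: rnorm_ge0.
pose T := [set complex.Re (f (o g)) | g in [set: G]].
have Tsup : has_sup T.
  split; first by exists (complex.Re (f (o g1))), g1.
  exists (opnorm f * M) => _ [g _ <-]; apply: le_trans (Re_dual_le _ _) _.
  by rewrite ler_wpM2l // opnorm_ge0.
pose B := sup T.
have fB g : complex.Re (f (o g)) <= B by apply: (ub_le_sup Tsup.2); exists g.
have aB : 0 < B - a by have := fB g1; lra.
(* A point below level [a] loses at least [2 * M + n] in [t f] against the supremum, while [k] can
   win back at most [2 * M]. *)
pose t := (2 * M + n) / (B - a).
have t0 : 0 < t by apply: divr_gt0 => //; lra.
have tB : t * (B - a) = 2 * M + n by rewrite /t mulfVK // gt_eqF.
pose b := n / (4 * t); have b0 : 0 < b by apply: divr_gt0 => //; lra.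
have tb : t * b = n / 4 by rewrite /b; field; rewrite gt_eqF.
have S0 : (0 : R) < (size S)%:R by rewrite ltr0n; case: (S) sS.
have [_ [g _ <-] hg] := sup_adherent (divr_gt0 b0 S0) Tsup.
have gb : (size S)%:R * (B - complex.Re (f (o g))) <= b.
  by rewrite mulrC -ler_pdivlMr // lerBlDr -lerBlDl ltW //; rewrite -/B in hg; lra.
have gsB := harmonic_near_max sS fB gb.
have gB : B - b <= complex.Re (f (o g)).
  have : B - complex.Re (f (o g)) <= (size S)%:R * (B - complex.Re (f (o g))).
    by rewrite ler_peMl ?subr_ge0 // ler1n -(ltr0n R).
  lra.
(* [o g] and [o (g * s)] are both near the maximum and at distance at least [4 * n], so one of them
   is at least [2 * n] away from [e]. *)
have [h hB hfar] : exists2 h, B - b <= complex.Re (f (o h)) & 2 * n <= rnorm (o h - e).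
  have := rnormD (o (g * s)%g - e) (e - o g); rewrite addrA subrK (rnormC e).
  have := sep g; have [near|far] := lerP (2 * n) (rnorm (o g - e)).
    by exists g.
  by exists (g * s)%g => //; lra.
have [k [kle kh]] := norming_functional (o h - e).
rewrite Re_dualB in kh.
(* The level separates [o h], whose value is at least [k (o h) + t B - n / 4], from hull points in
   the ball, whose values are at most [k (o h) + t B - n]. *)
exists (k + t%:C%C *: f), (complex.Re (k (o h)) + t * B - n / 2).
have fE x : complex.Re ((k + t%:C%C *: f) x) =
    complex.Re (k x) + t * complex.Re (f x).
  by rewrite bopD bopZ raddfD /=; case: (f x) => u v /=; rewrite mul0r subr0.
split.
- by exists h; rewrite fE; have := ler_wpM2l (ltW t0) hB; rewrite mulrBr; lra.
- move=> g'; rewrite fE leNgt => hg'; rewrite leNgt; apply/negP => fa.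
  move/negP: hg'; apply.
  have := kle (o g' - o h); rewrite Re_dualB => k1.
  have := rnormD (o g') (- o h); rewrite rnormN => k2.
  have := oM g'; have := oM h.
  have : t * complex.Re (f (o g')) < t * a by rewrite ltr_pM2l.
  move: tB; rewrite mulrBr; lra.
- move=> x /(_ f B fB) xB xe; rewrite fE.
  have := kle (x - e); rewrite Re_dualB => k1.
  have := ler_wpM2l (ltW t0) xB; lra.
Qed.

(* Nested slices avoiding balls centred at a dense sequence: a weak limit of
   points chosen in the slices lies in every slice, hence in no ball. *)
Lemma harmonic_not_separated (w : nat -> G) (s : G) (n : R) :
  reflexive_space X -> (forall g, exists k, w k = g) -> s \in S -> 0 < n ->
  ~ (forall g, 4 * n <= rnorm (o (g * s)%g - o g)).
Proof.
move=> Xr wsurj sS n0 sep.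
pose state := {fa : dual X * R | slice_nonempty fa.1 fa.2}.
(* The first slice is the whole orbit. *)
have st0P : slice_nonempty (0, -1 : R).1 (0 : dual X, -1 : R).2.
  by exists 1%g => /=; lra.
pose st0 : state := exist _ (0, -1) st0P.
(* A number coding no list yields the empty combination, whose ball is then avoided too. *)
pose c (k : nat) :=
  rat_comb (o \o w) (odflt ([::] : seq (rat * nat)) (choice.unpickle k)).
pose P (p : nat * state) (st : state) :=
  (forall g, (sval st).2 <= complex.Re ((sval st).1 (o g)) ->
     (sval p.2).2 <= complex.Re ((sval p.2).1 (o g))) /\
  (forall x, weak_hull x -> rnorm (x - c p.1) <= n ->
     complex.Re ((sval st).1 x) < (sval st).2).
have /choice [next hnext] p : exists st, P p st.
  case: p => k [[f a] fa].
  have [f' [a' [fa' h1 h2]]] := slice_avoiding_ball (c k) sS n0 sep fa.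
  by exists (exist _ (f', a') fa').
pose fix st k : state := if k is k'.+1 then next (k', st k') else st0.
have stP k : P (k, st k) (st k.+1) by exact: hnext.
have /choice [u hu] k : exists g,
  (sval (st k)).2 < complex.Re ((sval (st k)).1 (o g)) := svalP (st k).
have nested k m g :
    (sval (st (k + m)%N)).2 <= complex.Re ((sval (st (k + m)%N)).1 (o g)) ->
    (sval (st k)).2 <= complex.Re ((sval (st k)).1 (o g)).
  elim: m => [|m IH]; first by rewrite addn0.
  by rewrite addnS => /((stP (k + m)%N).1) /IH.
have [x hx] := reflexive_weak_limit Xr (fun k => oM (u k)).
have xh : weak_hull x.
  move=> f b fb; have := hx (- f) (- b); rewrite Re_dualN lerN2.
  by apply; exists 0%N => k _; rewrite Re_dualN lerN2.
(* Since [x] is in the hull, a functional nonpositive on the orbit is nonpositive at [x]; hence [x]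
   lies in one of the avoided balls. *)
have [|l hl] := @rat_comb_dense (o \o w) x _ n n0.
  move=> f fle; apply: xh => g; have [k <-] := wsurj g; exact: fle.
have ck : c (choice.pickle l) = rat_comb (o \o w) l by rewrite /c choice.pickleK.
have := (stP (choice.pickle l)).2 x xh; rewrite [(_, _).1]/= ck => /(_ hl).
rewrite ltNge => /negP; apply; apply: hx; exists (choice.pickle l).+1 => k lk.
apply: (@nested _ (k - (choice.pickle l).+1)%N); rewrite subnKC //; exact/ltW/hu.
Qed.

End Harmonic.

(** If [pi s z] differs from [z], isometry keeps [pi (g * s) z] and [pi g z] at one fixed positive
    distance for all [g], which [harmonic_not_separated] excludes. *)
Lemma orbit_harmonic_invariant (R : realType) (X : completeNormedModType R[i])
  (G : groupType) (w : nat -> G) (pi : representation G X) (S : seq G) (z : X) :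
  reflexive_space X -> (forall g, exists k, w k = g) ->
  (forall g x, rnorm (pi g x) = rnorm x) ->
  \sum_(s <- S) pi s z = (size S)%:R *: z ->
  forall s, s \in S -> pi s z = z.
Proof.
move=> Xr wsurj piI zh s sS.
have [/rnorm0_eq0/eqP|d0] := eqVneq (rnorm (pi s z - z)) 0.
  by rewrite subr_eq0 => /eqP.
have n0 : 0 < rnorm (pi s z - z) / 4.
  by rewrite divr_gt0 // lt_neqAle eq_sym d0 rnorm_ge0.
exfalso; apply: (@harmonic_not_separated R X G (fun g => pi g z) (rnorm z) S
  _ _ w s _ Xr wsurj sS n0) => [g|g|g].
- by rewrite piI.
- have -> : (size S)%:R *: pi g z = pi g ((size S)%:R *: z).
    by rewrite (bop_scale (pi g)).
  rewrite -zh (big_morph (pi g) (bop_add (pi g)) (bop0 (pi g))).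
  by apply: eq_bigr => t _; rewrite repM.
- rewrite repM compopE.
  have -> : pi g (pi s z) - pi g z = pi g (pi s z - z).
    by rewrite bop_sub.
  rewrite piI; lra.
Qed.

(** * Ultraproducts of representations *)

Section Ultraclass.
Context {R : realType} {I : Type} {U : set_system I} {UU : UltraFilter U}.
Context {E : I -> completeNormedModType R[i]}.
Implicit Types v w : bounded_family E.

Definition uclass v : ultraproduct UU E :=
  sepquot_pi (CompleteSeminorm (@ultra_sn_complete R I U UU E)) v.

Lemma uclass_surj x : exists v, uclass v = x.
Proof. by exists (sepquot_repr x); exact: sepquot_reprK. Qed.

Lemma uclassD v w : uclass (v + w) = uclass v + uclass w.
Proof. exact: sepquot_piD. Qed.

Lemma uclassZ a v : uclass (a *: v) = a *: uclass v.
Proof. by rewrite [RHS]sepquot_piZ. Qed.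

Lemma rnorm_uclass v : rnorm (uclass v) = @ultra_norm R I U E v.
Proof. exact: sepquot_rnormE. Qed.

Lemma uclass_le v e : U [set i | rnorm (v i) <= e] -> rnorm (uclass v) <= e.
Proof. by rewrite rnorm_uclass; exact: ultra_norm_le. Qed.

Lemma uclass_lt v e : rnorm (uclass v) < e -> U [set i | rnorm (v i) < e].
Proof. by rewrite rnorm_uclass; exact: ultra_norm_lt. Qed.

Lemma uclassB v w : uclass (v - w) = uclass v - uclass w.
Proof. by rewrite uclassD -scaleN1r uclassZ scaleN1r. Qed.

Lemma uclass0 : uclass 0 = 0.
Proof. by rewrite -(subrr (0 : bounded_family E)) uclassB subrr. Qed.

Lemma uclass_eq v w :
  (forall e, 0 < e -> U [set i | rnorm (v i - w i) <= e]) <->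
  uclass v = uclass w.
Proof.
split=> [h|h e e0].
  apply/eqP; rewrite -subr_eq0 -uclassB; apply/eqP/rnorm0_eq0/eqP.
  rewrite eq_le rnorm_ge0 andbT; apply/ler_addgt0Pr => e /h he.
  by rewrite add0r; exact: uclass_le.
have : rnorm (uclass (v - w)) < e by rewrite uclassB h subrr rnorm0.
by move/uclass_lt; apply: filterS => i /= /ltW.
Qed.

End Ultraclass.

(** * The limit representation on an ultraproduct *)

Section UltraRepresentation.
Context {R : realType} {G : groupType}.
Context {U : set_system nat} {UU : UltraFilter U}.
Hypothesis NU : \oo `<=` U.
Context {E : nat -> completeNormedModType R[i]}.
Context (pi : forall k, representation G (E k)) (l : G -> R).
Hypothesis l0 : forall g, 0 <= l g.
Hypothesis piP : forall k g, rnorm (pi k g) <= expR (k.+1%:R^-1 * l g).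

Local Notation X := (ultraproduct UU E).

Lemma pi_bounded k g x : rnorm (pi k g x) <= expR (l g) * rnorm x.
Proof.
apply: le_trans (opnormP _ _) _; rewrite ler_wpM2r ?rnorm_ge0 //.
rewrite -rnorm_opE; apply: le_trans (piP k g) _; rewrite ler_expR.
by rewrite ler_piMl // invf_le1 // ler1n.
Qed.

Lemma growth_to_1 g (e : R) : 0 < e ->
  U [set k | forall x, rnorm (pi k g x) <= (1 + e) * rnorm x].
Proof.
move=> e0; have le0 : 0 < ln (1 + e) by rewrite ln_gt0 // ltrDl.
apply: NU; exists (Num.truncn (l g / ln (1 + e))).+1 => // k /= hk x.
apply: le_trans (opnormP _ _) _; rewrite ler_wpM2r ?rnorm_ge0 //.
rewrite -rnorm_opE; apply: le_trans (piP k g) _.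
rewrite -[leRHS]lnK; last by rewrite posrE; lra.
rewrite ler_expR mulrC ler_pdivrMr // mulrC -ler_pdivrMr //.
apply: le_trans (ltW (truncnS_gt _)) _; rewrite ler_nat.
exact: leq_trans hk (leqnSn _).
Qed.

Fact fam_act_subproof g (v : bounded_family E) :
  exists M, forall k, rnorm (pi k g (v k)) <= M.
Proof.
have [M hM] := bfP v; exists (expR (l g) * M) => k.
apply: le_trans (pi_bounded g _) _; exact: ler_wpM2l (expR_ge0 _) _ _ (hM k).
Qed.

Definition fam_act g v : bounded_family E := BoundedFamily (fam_act_subproof g v).

(** The bounds on [pi k g] tend to 1, so no constant survives in the limit. Applied to differences,
    this makes the action well defined on classes. *)
Lemma uclass_act_le g v :
  rnorm (uclass (UU := UU) (fam_act g v)) <= rnorm (uclass (UU := UU) v).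
Proof.
apply/ler_addgt0Pr => e e0; have v0 := rnorm_ge0 (uclass (UU := UU) v).
set r := rnorm _ in v0 *.
(* With [d] this quotient, [d <= e] and so [(1 + d) * (r + d) <= r + d * (r + e + 1) = r + e]. *)
have d0 : 0 < e / (r + e + 1) by apply: divr_gt0 => //; lra.
have rd : r < r + e / (r + e + 1) by rewrite ltrDl.
apply: uclass_le.
apply: filterS2 (growth_to_1 g d0) (uclass_lt rd) => k /= h1 h2.
apply: le_trans (h1 _) _; apply: le_trans (ler_wpM2l _ (ltW h2)) _; first lra.
set d := e / _ in d0 *; have dE : d * (r + e + 1) = e by rewrite mulfVK // gt_eqF //; lra.
have d1 : d <= e by nra.
nra.
Qed.

Definition uact g (x : X) : X := uclass (fam_act g (projT1 (cid (uclass_surj x)))).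

Lemma uactE g v : uact g (uclass v) = uclass (fam_act g v).
Proof.
rewrite /uact; case: cid => w /= hw.
apply/eqP; rewrite -subr_eq0 -uclassB; apply/eqP/rnorm0_eq0/eqP.
rewrite eq_le rnorm_ge0 andbT.
have -> : fam_act g w - fam_act g v = fam_act g (w - v).
  by apply: bf_ext => k /=; rewrite bop_sub.
by apply: le_trans (uclass_act_le g _) _; rewrite uclassB hw subrr rnorm0.
Qed.

Fact uact_subproof g : uact g \in bounded_op.
Proof.
rewrite inE; split=> [a x y|].
  have [v <-] := uclass_surj x; have [w <-] := uclass_surj y.
  rewrite -uclassZ -uclassD !uactE -uclassZ -uclassD; congr uclass.
  by apply: bf_ext => k /=; rewrite bop_add bop_scale.
exists 1 => x; have [v <-] := uclass_surj x.
by rewrite mul1r uactE uclass_act_le.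
Qed.

Definition urep_op g := BoundedOp (uact_subproof g).

Fact urep1 : urep_op 1%g = idop X.
Proof.
apply: bop_ext => x; have [v <-] := uclass_surj x.
rewrite [LHS]uactE; congr uclass; apply: bf_ext => k /=.
by rewrite rep1.
Qed.

Fact urepM g h : urep_op (g * h)%g = compop (urep_op g) (urep_op h).
Proof.
apply: bop_ext => x; have [v <-] := uclass_surj x.
rewrite compopE [LHS]uactE [urep_op h _]uactE [RHS]uactE; congr uclass.
by apply: bf_ext => k /=; rewrite repM.
Qed.

Definition urep : representation G X := Representation urep1 urepM.

Lemma urepE g v : urep g (uclass v) = uclass (fam_act g v).
Proof. exact: uactE. Qed.

(** Both [urep g] and its inverse [urep g^-1] are contractions. *)
Lemma urep_isometric g x : rnorm (urep g x) = rnorm x.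
Proof.
have le h y : rnorm (urep h y) <= rnorm y.
  by have [v <-] := uclass_surj y; rewrite urepE uclass_act_le.
apply/eqP; rewrite eq_le le /=.
have := le g^-1%g (urep g x); rewrite -compopE -repM mulVg rep1 //.
Qed.

(** * The affine action defined by a cocycle *)

Section AffineAction.
Variable b : G -> bounded_family E.
Hypothesis bM : forall g h k, b (g * h)%g k = pi k g (b h k) + b g k.

Definition uaff g (x : X) : X := urep g x + uclass (b g).

Fact uaffM g h x : uaff (g * h)%g x = uaff g (uaff h x).
Proof.
rewrite /uaff repM compopE bop_add -addrA; congr (_ + _).
rewrite urepE -uclassD; congr uclass; apply: bf_ext => k.
exact: bM.
Qed.

Fact uaff1 x : uaff 1%g x = x.
Proof.
rewrite /uaff rep1 /= [X in _ + uclass X](_ : _ = 0).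
  by rewrite uclass0 addr0.
apply: bf_ext => k; have := bM 1%g 1%g k; rewrite mulg1 rep1 /= => /eqP.
by rewrite -subr_eq0 opprD addNKr oppr_eq0 => /eqP.
Qed.

Fact uaff_affine g : exists (L : {linear X -> X}) (c : X),
  forall x, uaff g x = L x + c.
Proof.
pose L : {linear X -> X} :=
  HB.pack (urep g : X -> X)
    (GRing.isLinear.Build R[i] X X _ (urep g) (bop_linear (urep g))).
by exists L, (uclass (b g)).
Qed.

Fact uaff_isometric g x y : `|uaff g x - uaff g y| = `|x - y|.
Proof.
by rewrite /uaff opprD addrACA subrr addr0 -bop_sub !rnormE urep_isometric.
Qed.

Definition uaction : affine_isometric_action G X :=
  AffineAction uaff1 uaffM uaff_affine uaff_isometric.

End AffineAction.
End UltraRepresentation.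

(** * Displacement and almost invariant corrections *)

Section Isometric.
Context {R : realType}.
Implicit Types X Y : completeNormedModType R[i].

(** Used to transport properties between an ultraproduct, or a space of the collection, and the
    member of [cE] isometric to it. *)
Lemma isometric_ops X Y : isometric X Y ->
  exists (f : boundedOp X Y) (h : boundedOp Y X),
    [/\ cancel f h, cancel h f, forall x, rnorm (f x) = rnorm x &
        forall y, rnorm (h y) = rnorm y].
Proof.
move=> [f [fI fS]]; have fN x : rnorm (f x) = rnorm x by rewrite /rnorm fI.
have /choice [h hK] y : exists x, f x = y.
  have [x _ <-] : range f y by rewrite fS.
  by exists x.
have hN y : rnorm (h y) = rnorm y by rewrite -fN hK.
have fh : cancel f h.
  move=> x; apply/eqP; rewrite -subr_eq0; apply/eqP/rnorm0_eq0.
  by rewrite -fN linearB hK subrr rnorm0.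
have fP : (f : X -> Y) \in bounded_op.
  rewrite inE; split; first exact: linearP.
  by exists 1 => x; rewrite fN mul1r.
have hP : h \in bounded_op.
  rewrite inE; split; last by exists 1 => x; rewrite hN mul1r.
  by move=> a x y; rewrite -[RHS]fh linearP !hK.
by exists (BoundedOp fP), (BoundedOp hP).
Qed.

(** The isometry itself shows that [X] is finitely representable in [Y]. *)
Lemma reflexive_isometric X Y :
  superreflexive Y -> isometric X Y -> reflexive_space X.
Proof.
move=> Yr /isometric_ops [f [_ [_ _ fN _]]]; apply: Yr => n v e e0.
exists f; split=> [a x y _ _|x _]; first exact: bop_linear.
by rewrite fN lexx ler_peMl ?rnorm_ge0 // lerDl ltW.
Qed.

Lemma fixed_point_isometric (G : groupType)
    (cE : completeNormedModType R[i] -> Prop) X Y :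
  fixed_point_property G cE -> cE Y -> isometric X Y ->
  forall alpha : affine_isometric_action G X, exists x, forall g, alpha g x = x.
Proof.
move=> FE EY /isometric_ops [f [h [fh hf fN hN]]] alpha.
pose beta g y := f (alpha g (h y)).
have beta1 y : beta 1%g y = y by rewrite /beta aff_act1 hf.
have betaM g k y : beta (g * k)%g y = beta g (beta k y).
  by rewrite /beta fh aff_actM.
have beta_affine g : exists (L : {linear Y -> Y}) b, forall y, beta g y = L y + b.
  have [L [b Lb]] := aff_act_affine alpha g.
  have lP : linear (fun y => f (L (h y))).
    by move=> a x y; rewrite bop_linear linearP bop_linear.
  pose L' : {linear Y -> Y} := HB.pack (fun y => f (L (h y)))
    (GRing.isLinear.Build R[i] Y Y _ (fun y => f (L (h y))) lP).
  by exists L', (f b) => y; rewrite /beta Lb bop_add.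
have beta_isometric g x y : `|beta g x - beta g y| = `|x - y|.
  rewrite /beta -bop_sub rnormE fN -rnormE aff_act_isometric.
  by rewrite -bop_sub !rnormE hN.
have [y hy] := FE Y EY (AffineAction beta1 betaM beta_affine beta_isometric).
by exists (h y) => g; rewrite -[LHS]fh; congr (h _); exact: hy.
Qed.

End Isometric.

Lemma filter_all_seq (T : Type) (J : eqType) (F : set_system T) (r : seq J)
    (P : J -> T -> Prop) : Filter F ->
  (forall j, j \in r -> F (P j)) -> F [set t | forall j, j \in r -> P j t].
Proof.
move=> FF; elim: r => [_|j r IH h]; first by apply: filterE.
have hr : F [set t | forall k, k \in r -> P k t].
  by apply: IH => k kr; apply: h; rewrite inE kr orbT.
apply: filterS2 (h j (mem_head _ _)) hr => t /= Pj Pr k.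
by rewrite inE => /predU1P[->|/Pr].
Qed.

(** * Displacement under the generators *)

Section Displacement.
Context {R : realType} {G : groupType} (S : generating_set G) (L : seq G).
Hypothesis SL : S = [set` L] :> set G.
Implicit Types E : completeNormedModType R[i].

Definition growth (c : R) E (pi : representation G E) : Prop :=
  forall g, rnorm (pi g) <= expR (c * (word_length S g)%:R).

Definition disp E (pi : representation G E) (x : E) : R :=
  \sum_(s <- L) rnorm (pi s x - x).

Lemma growth_le c c' E (pi : representation G E) :
  c <= c' -> growth c pi -> growth c' pi.
Proof.
move=> cc h g; apply: le_trans (h g) _.
by rewrite ler_expR ler_wpM2r.
Qed.

Lemma growthP E (pi : representation G E) c g x : growth c pi ->
  rnorm (pi g x) <= expR (c * (word_length S g)%:R) * rnorm x.
Proof.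
move=> h; apply: le_trans (opnormP _ _) _.
by rewrite ler_wpM2r ?rnorm_ge0 //; exact: h.
Qed.

Section Rep.
Context E (pi : representation G E).

Lemma disp_ge0 x : 0 <= disp pi x.
Proof. by apply: sumr_ge0 => s _; exact: rnorm_ge0. Qed.

Lemma disp_ge s x : s \in L -> rnorm (pi s x - x) <= disp pi x.
Proof.
move=> sL; rewrite /disp (big_rem s) //= lerDl.
by apply: sumr_ge0 => t _; exact: rnorm_ge0.
Qed.

Lemma dispD x y : disp pi (x + y) <= disp pi x + disp pi y.
Proof.
rewrite /disp -big_split; apply: ler_sum => s _ /=.
by rewrite bop_add opprD addrACA rnormD.
Qed.

Lemma dispZ a x : disp pi (a *: x) = rnorm a * disp pi x.
Proof.
rewrite /disp mulr_sumr; apply: eq_bigr => s _.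
by rewrite bop_scale -scalerBr rnormZ.
Qed.

Lemma dispN x : disp pi (- x) = disp pi x.
Proof. by rewrite -[- x]scaleN1r dispZ rnormN rnorm1 mul1r. Qed.

Lemma disp0 : disp pi 0 = 0.
Proof. by rewrite -(scale0r 0) dispZ rnorm0 mul0r. Qed.

(** The stabilizer of [x] is a subgroup containing the generators. *)
Lemma generators_invariant x : (forall s, s \in L -> pi s x = x) ->
  invariants pi x.
Proof.
move=> Lx; suff : [set g | pi g x = x] = [set: G].
  by move=> E1 g; have : [set: G] g by []; rewrite -E1.
apply: (@gs_generates G S) => /=.
- by rewrite rep1.
- by move=> g h gx hx; rewrite repM compopE hx gx.
- by move=> g gx; rewrite -{1}gx -compopE -repM mulVg rep1.
- by move=> s; rewrite SL => /Lx.
Qed.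

Lemma disp_eq0 x : disp pi x = 0 <-> invariants pi x.
Proof.
split=> [x0|hx]; last by apply: big1 => s _; rewrite hx subrr rnorm0.
apply: generators_invariant => s sL; apply/eqP; rewrite -subr_eq0.
apply/eqP/rnorm0_eq0/eqP; rewrite eq_le rnorm_ge0 andbT -x0.
exact: disp_ge.
Qed.

Lemma disp_invariant x y : invariants pi y -> disp pi (x - y) = disp pi x.
Proof.
move=> hy; apply: eq_bigr => s _.
by rewrite bop_sub hy opprB addrA subrK.
Qed.

End Rep.

Lemma disp_bound : exists2 B : R, 0 < B &
  forall E (pi : representation G E), growth 1 pi ->
  forall x, disp pi x <= B * rnorm x.
Proof.
exists (\sum_(s <- L) (expR (word_length S s)%:R + 1) + 1).
  by rewrite ltr_wpDl // sumr_ge0 // => s _; rewrite addr_ge0 ?expR_ge0.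
move=> E pi pi1 x; rewrite mulrDl mul1r.
apply: le_trans (_ : \sum_(s <- L) (expR (word_length S s)%:R + 1) * rnorm x <= _).
  apply: ler_sum => s _; apply: le_trans (rnormD _ _) _.
  rewrite rnormN mulrDl mul1r lerD2r.
  by have := growthP s x pi1; rewrite mul1r.
by rewrite mulr_suml lerDl rnorm_ge0.
Qed.

(** The elements [g] admitting such a uniform [K] form a subgroup containing [S], by the cocycle
    identity for [pi g x - x]. Uniformity in [pi] makes sequences of coboundaries bounded
    families. *)
Lemma rep_disp_bound g : exists2 K : R, 0 <= K &
  forall E (pi : representation G E), growth 1 pi ->
  forall x, rnorm (pi g x - x) <= K * disp pi x.
Proof.
pose H : set G := [set g | exists2 K : R, 0 <= K &
  forall E (pi : representation G E), growth 1 pi ->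
  forall x, rnorm (pi g x - x) <= K * disp pi x].
suff HT : H = [set: G] by have : [set: G] g by []; rewrite -HT.
apply: (@gs_generates G S).
- by exists 0 => // E pi _ x; rewrite rep1 subrr rnorm0 mul0r.
- move=> h k [K K0 hK] [K' K'0 hK'].
  exists (expR (1 * (word_length S h)%:R) * K' + K).
    by rewrite addr_ge0 // mulr_ge0 // expR_ge0.
  move=> E pi pi1 x; have -> : pi (h * k)%g x - x = pi h (pi k x - x) + (pi h x - x).
    by rewrite repM compopE bop_sub addrA subrK.
  apply: le_trans (rnormD _ _) _; rewrite mulrDl -mulrA lerD ?hK //.
  apply: le_trans (growthP h _ pi1) _.
  by rewrite ler_wpM2l ?expR_ge0 ?hK'.
- move=> h [K K0 hK]; exists (expR (1 * (word_length S h^-1%g)%:R) * K).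
    by rewrite mulr_ge0 // expR_ge0.
  move=> E pi pi1 x; have -> : pi h^-1%g x - x = - pi h^-1%g (pi h x - x).
    by rewrite bop_sub -compopE -repM mulVg rep1 opprB.
  rewrite rnormN -mulrA; apply: le_trans (growthP _ _ pi1) _.
  by rewrite ler_wpM2l ?expR_ge0 ?hK.
- move=> s; rewrite SL => sL; exists 1 => // E pi _ x; rewrite mul1r.
  exact: disp_ge.
Qed.

Lemma disp_eventually_le (U : set_system nat) (UU : UltraFilter U)
    (E : nat -> completeNormedModType R[i]) (pi : forall k, representation G (E k))
    (x : forall k, E k) :
  (forall s e, s \in L -> 0 < e -> U [set k | rnorm (pi k s (x k) - x k) <= e]) ->
  forall e, 0 < e -> U [set k | disp (pi k) (x k) <= e].
Proof.
move=> h e e0; have d0 : 0 < e / (size L).+1%:R by apply: divr_gt0.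
have hL : U [set k | forall s, s \in L ->
    rnorm (pi k s (x k) - x k) <= e / (size L).+1%:R].
  by apply: filter_all_seq => s sL; exact: h.
apply: filterS hL => k /= hk.
apply: le_trans (_ : \sum_(s <- L) e / (size L).+1%:R <= _).
  by rewrite /disp big_seq [leRHS]big_seq; apply: ler_sum => s /hk.
rewrite big_const_seq count_predT iter_addr_0 -[_ / _ *+ _]mulr_natl mulrCA.
by rewrite ler_piMr ?(ltW e0) // ler_pdivrMr // mul1r ler_nat.
Qed.

Record pointed_rep := PointedRep {
  pr_space : completeNormedModType R[i];
  pr_rep : representation G pr_space;
  pr_vec : pr_space }.

Section FixedPoint.
Variable cE : completeNormedModType R[i] -> Prop.
Hypothesis cE_superreflexive : forall X, cE X -> superreflexive X.
Hypothesis cE_ultraproducts : stable_by_ultraproducts cE.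
Hypothesis G_FE : fixed_point_property G cE.

(** One integer sets both the growth rate and the constant: its failure for every [n] gives
    representations with rates tending to 0 whose small-displacement corrections must be ever
    larger. *)
Lemma approx_invariant : exists n : nat, forall E, cE E ->
  forall pi : representation G E, growth n.+1%:R^-1 pi ->
  forall x, exists y,
    rnorm y <= n.+1%:R * disp pi x /\ disp pi (x - y) <= disp pi x / 2.
Proof.
apply: contrapT => no.
have /choice [P hP] n : exists P : pointed_rep,
    [/\ cE (pr_space P), growth n.+1%:R^-1 (pr_rep P),
        disp (pr_rep P) (pr_vec P) = 1 &
        forall y, rnorm y <= n.+1%:R ->
          2^-1 < disp (pr_rep P) (pr_vec P - y)].
  apply: contrapT => noP; apply: no; exists n => E EE pi pin x.
  have [x0|x0] := eqVneq (disp pi x) 0.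
    by exists 0; rewrite rnorm0 x0 subr0 x0 mulr0 mul0r.
  have xgt0 : 0 < disp pi x by rewrite lt_neqAle eq_sym x0 disp_ge0.
  apply: contrapT => nox; apply: noP.
  (* The counterexample is rescaled to displacement 1. *)
  exists (PointedRep pi ((disp pi x)^-1%:C%C *: x)); split=> //=.
    by rewrite dispZ rnormR gtr0_norm ?invr_gt0 // mulVf.
  move=> y yn; rewrite ltNge; apply/negP => hy; apply: nox.
  exists ((disp pi x)%:C%C *: y).
  rewrite rnormZ rnormR gtr0_norm // [_ * rnorm y]mulrC ler_wpM2r ?disp_ge0 //.
  split=> //; move: hy.
  have -> : (disp pi x)^-1%:C%C *: x - y =
      (disp pi x)^-1%:C%C *: (x - (disp pi x)%:C%C *: y).
    by rewrite scalerBr scalerA -rmorphM mulVf // scale1r.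
  by rewrite dispZ rnormR gtr0_norm ?invr_gt0 // ler_pdivrMl.
have [U [UU NU]] := @ultraFilterLemma nat \oo _.
pose E k := pr_space (P k); pose pi k : representation G (E k) := pr_rep (P k).
pose x k : E k := pr_vec (P k).
have hcE k : cE (E k) by have [] := hP k.
have piP k g : rnorm (pi k g) <= expR (k.+1%:R^-1 * (word_length S g)%:R).
  by have [_ h _ _] := hP k; exact: h.
have pi1 k : growth 1 (pi k).
  by apply: (@growth_le k.+1%:R^-1); [rewrite invf_le1 ?ler1n|exact: piP].
have bP g : exists M, forall k, rnorm (pi k g (x k) - x k) <= M.
  have [K K0 hK] := rep_disp_bound g; exists K => k.
  apply: le_trans (hK _ _ (pi1 k) _) _.
  by have [_ _ -> _] := hP k; rewrite mulr1.
pose b g := BoundedFamily (bP g).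
have bM g h k : b (g * h)%g k = pi k g (b h k) + b g k.
  by rewrite /= repM compopE bop_sub addrA subrK.
have [Y [EY XY]] := cE_ultraproducts UU hcE.
have [z hz] := fixed_point_isometric G_FE EY XY
  (uaction (UU := UU) NU (fun g => ler0n _ _) piP bM).
have [v vz] := uclass_surj z.
(* The fixed point equation for the class of [v] says that each generator almost fixes [x k + v k]
   along [U]; thus [- v k] is a good correction of [x k]. *)
have hv := @disp_eventually_le U UU E pi (fun k => x k + v k) _ 2^-1.
have {}hv : U [set k | disp (pi k) (x k + v k) <= 2^-1].
  apply: hv => [s e _ e0|]; last by rewrite invr_gt0.
  have := hz s; rewrite /= /uaff -vz urepE -uclassD => /uclass_eq /(_ e e0).
  apply: filterS => k /=; rewrite bop_add.
  by rewrite addrA [pi k s (v k) + _]addrC opprD addrA.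
have [M hM] := bfP v.
(* Eventually [k.+1] exceeds the bound of [v], so [- v k] is among the corrections ruled out for
   [P k]. *)
have UM : U [set k | M <= k.+1%:R].
  apply: (NU); exists (Num.truncn M) => // k /= hk.
  by apply: le_trans (ltW (truncnS_gt _)) _; rewrite ler_nat.
have [k [hk kM]] := filter_ex (filterI hv UM).
have [_ _ _ bad] := hP k.
have := bad (- v k); rewrite rnormN => /(_ (le_trans (hM k) kM)).
by rewrite opprK ltNge => /negP; apply.
Qed.

End FixedPoint.
End Displacement.

(** * The group algebra and random walks *)

Section Augmentation.
Context {R : realType} {G : groupType}.
Local Notation A := (group_algebra R G).
Implicit Types a b : A.

(** The character of C[G] given by the trivial representation; value 1 is the mass condition on
    Kazhdan projections. *)
Definition augmentation a : R[i] := \sum_(g <- msupp a) a@_g.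

Lemma augmentationw (d : {fset G}) a : (msupp a `<=` d)%fset ->
  augmentation a = \sum_(g <- d) a@_g.
Proof.
by move=> le; rewrite /augmentation (big_fset_incl _ le) //= => g _ /mcoeff_outdom.
Qed.

Lemma augmentationD a b :
  augmentation (a + b) = augmentation a + augmentation b.
Proof.
pose d := (msupp a `|` msupp b)%fset.
rewrite !(@augmentationw d) ?fsubsetUl ?fsubsetUr ?msuppD_le // -big_split /=.
by apply: eq_bigr => g _; rewrite mcoeffD.
Qed.

Lemma augmentationZ s a : augmentation (s *: a) = s * augmentation a.
Proof.
rewrite (@augmentationw (msupp a)) ?msuppZ_le // mulr_sumr.
by apply: eq_bigr => g _; rewrite mcoeffZ.
Qed.

Lemma augmentation0 : augmentation 0 = 0.
Proof. by rewrite -(scale0r (0 : A)) augmentationZ mul0r. Qed.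

Lemma augmentationU (x : R[i]) (g : G) : augmentation << x *g g >> = x.
Proof. by rewrite (augmentationw msuppU_le) big_seq_fset1 mcoeffUU. Qed.

Lemma augmentationM a b :
  augmentation (a * b) = augmentation a * augmentation b.
Proof.
elim/ga_ind: a => [x g||a a' IH IH'].
- elim/ga_ind: b => [y h||b b' IH IH'].
  + by rewrite [_ * _]ga_mulUU !augmentationU.
  + by rewrite mulr0 augmentation0 mulr0.
  + by rewrite mulrDr !augmentationD IH IH' mulrDr.
- by rewrite mul0r augmentation0 mul0r.
- by rewrite mulrDl !augmentationD IH IH' mulrDl.
Qed.

Lemma augmentation1 : augmentation 1 = 1.
Proof. exact: augmentationU. Qed.

Lemma augmentationX a n : augmentation a = 1 -> augmentation (a ^+ n) = 1.
Proof.
move=> a1; elim: n => [|n IH]; first exact: augmentation1.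
by rewrite exprS augmentationM a1 IH mulr1.
Qed.

Context {E : completeNormedModType R[i]} (pi : representation G E).

Lemma rep_alg_sumE a x : rep_alg pi a x = \sum_(g <- msupp a) a@_g *: pi g x.
Proof.
by apply: (big_morph (fun f : boundedOp E E => f x)).
Qed.

Lemma rep_alg_invariants a x :
  invariants pi x -> rep_alg pi a x = augmentation a *: x.
Proof.
move=> hx; rewrite rep_alg_sumE scaler_suml.
by apply: eq_bigr => g _; rewrite hx.
Qed.

Lemma rep_alg1 : rep_alg pi 1 = idop E.
Proof. by rewrite rep_algU scale1r rep1. Qed.

Lemma rep_algX a n x : rep_alg pi (a ^+ n) x = iter n (rep_alg pi a) x.
Proof.
elim: n x => [|n IH] x; first by rewrite rep_alg1.
by rewrite exprS rep_algM compopE IH.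
Qed.

Lemma rep_alg_sum (I : Type) (r : seq I) (F : I -> A) x :
  rep_alg pi (\sum_(j <- r) F j) x = \sum_(j <- r) rep_alg pi (F j) x.
Proof.
apply: (big_morph (fun a => rep_alg pi a x)) => [a b|].
  by rewrite rep_algD.
by rewrite rep_alg0.
Qed.

End Augmentation.

(** * Cesaro means of the random walk *)

Section WalkMeans.
Context {R : realType} {G : groupType} (S : generating_set G) (L : seq G).
Hypothesis SL : S = [set` L] :> set G.
Local Notation A := (group_algebra R G).
Implicit Types E : completeNormedModType R[i].

(** A word in the generators is a list of indices into [L], hence coded by a number. *)
Lemma generated_countable : exists w : nat -> G, forall g, exists k, w k = g.
Proof.
pose w (k : nat) : G := foldr (fun j g => (nth 1%g L j * g)%g) 1%g
  (odflt ([::] : seq nat) (choice.unpickle k)).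
exists w => g; have [n /asboolP] := set_pow_ex S g; elim: n g => [|n IH] g /=.
  by move=> ->; exists (choice.pickle ([::] : seq nat)); rewrite /w choice.pickleK.
move=> [s sS [h /IH [k wk] <-]]; have sL : s \in L by move: sS; rewrite SL.
exists (choice.pickle (index s L :: odflt ([::] : seq nat) (choice.unpickle k))).
by rewrite /w choice.pickleK /= nth_index // -wk.
Qed.

Lemma word_length_generator s : s \in L -> (word_length S s <= 1)%N.
Proof.
move=> sL; rewrite /word_length; case: ex_minnP => n _; apply; apply/asboolP.
by exists s; [rewrite SL|exists 1%g; rewrite ?mulg1].
Qed.

Lemma generators_nonempty : (0 < size L)%N.
Proof. by have := gs1 S; rewrite SL /=; case: (L). Qed.

Definition walk : A := (size L)%:R^-1 *: \sum_(s <- L) << 1 *g s >>.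

Definition walk_mean (N : nat) : A := N%:R^-1 *: \sum_(0 <= j < N) walk ^+ j.

Lemma augmentation_walk : augmentation walk = 1.
Proof.
rewrite augmentationZ (big_morph _ (@augmentationD R G) (@augmentation0 R G)).
rewrite (eq_bigr (fun=> 1)) => [|s _]; last exact: augmentationU.
rewrite big_const_seq count_predT iter_addr_0 mulVf //.
by rewrite pnatr_eq0 -lt0n generators_nonempty.
Qed.

Lemma augmentation_walk_mean N : (0 < N)%N -> augmentation (walk_mean N) = 1.
Proof.
move=> N0; rewrite augmentationZ (big_morph _ (@augmentationD R G) (@augmentation0 R G)).
rewrite (eq_bigr (fun=> 1)) => [|j _]; last exact/augmentationX/augmentation_walk.
by rewrite big_const_nat subn0 iter_addr_0 mulVf // pnatr_eq0 -lt0n.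
Qed.

Section Rep.
Context E (pi : representation G E) (c : R) (pic : growth S c pi) (c0 : 0 <= c).

Lemma rep_walkE x : rep_alg pi walk x = (size L)%:R^-1 *: \sum_(s <- L) pi s x.
Proof.
rewrite rep_algZ bopZ rep_alg_sum; congr (_ *: _); apply: eq_bigr => s _.
by rewrite rep_algU scale1r.
Qed.

Lemma rnorm_walk x : rnorm (rep_alg pi walk x) <= expR c * rnorm x.
Proof.
rewrite rep_walkE rnormZ.
have -> : rnorm ((size L)%:R^-1 : R[i]) = (size L)%:R^-1.
  by rewrite -(rmorph_nat (real_complex R)) -fmorphV rnormR ger0_norm // invr_ge0.
rewrite ler_pdivrMl ?ltr0n ?generators_nonempty //.
apply: le_trans (_ : \sum_(s <- L) expR c * rnorm x <= _); last first.
  by rewrite big_const_seq count_predT iter_addr_0 mulr_natl.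
rewrite big_seq [leRHS]big_seq.
apply: (big_ind2 (fun (y : E) r => rnorm y <= r)) => [|y r y' r' h h'|s sL].
- by rewrite rnorm0.
- by apply: le_trans (rnormD _ _) _; exact: lerD.
- apply: le_trans (growthP s x pic) _; rewrite ler_wpM2r ?rnorm_ge0 //.
  by rewrite ler_expR ler_piMr // -[leRHS]/(1%:R) ler_nat word_length_generator.
Qed.

Lemma rnorm_walk_iter j x :
  rnorm (iter j (rep_alg pi walk) x) <= expR (c * j%:R) * rnorm x.
Proof.
elim: j => [|j IH] /=; first by rewrite mulr0 expR0 mul1r.
apply: le_trans (rnorm_walk _) _.
rewrite -natr1 mulrDr mulr1 addrC expRD -mulrA.
by rewrite ler_wpM2l ?expR_ge0.
Qed.

Context (N : nat) (N0 : (0 < N)%N) (cN : c * N%:R <= 1).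

(** The coupling [c * N <= 1] of rate and time keeps the iterates up to [N] bounded, although [pi]
    is not isometric. *)
Lemma rnorm_walk_iter_le j x : (j <= N)%N ->
  rnorm (iter j (rep_alg pi walk) x) <= expR 1 * rnorm x.
Proof.
move=> jN; apply: le_trans (rnorm_walk_iter _ _) _.
rewrite ler_wpM2r ?rnorm_ge0 // ler_expR (le_trans _ cN) //.
by rewrite ler_wpM2l // ler_nat.
Qed.

Lemma rep_walk_meanE x : rep_alg pi (walk_mean N) x =
  N%:R^-1 *: \sum_(0 <= j < N) iter j (rep_alg pi walk) x.
Proof.
rewrite [in LHS]/walk_mean [in LHS]rep_algZ bopZ; congr (_ *: _).
rewrite [LHS]rep_alg_sum; apply: eq_bigr => j _; exact: rep_algX.
Qed.

Lemma rnorm_invN : rnorm (N%:R^-1 : R[i]) = N%:R^-1.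
Proof.
by rewrite -(rmorph_nat (real_complex R)) -fmorphV rnormR ger0_norm // invr_ge0.
Qed.

Lemma rnorm_walk_mean x : rnorm (rep_alg pi (walk_mean N) x) <= expR 1 * rnorm x.
Proof.
rewrite rep_walk_meanE rnormZ rnorm_invN ler_pdivrMl ?ltr0n //.
apply: le_trans (_ : \sum_(0 <= j < N) expR 1 * rnorm x <= _); last first.
  by rewrite big_const_nat subn0 iter_addr_0 mulr_natl.
rewrite big_nat [leRHS]big_nat.
apply: (big_ind2 (fun (y : E) r => rnorm y <= r)) => [|y r y' r' h h'|j jN].
- by rewrite rnorm0.
- by apply: le_trans (rnormD _ _) _; exact: lerD.
- by apply: rnorm_walk_iter_le; apply: ltnW; case/andP: jN.
Qed.

(** Telescoping: applying [T - 1] to the mean of the iterates leaves [(T^N x - x) / N]. *)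
Lemma walk_mean_almost_harmonic x z : z = rep_alg pi (walk_mean N) x ->
  rnorm (rep_alg pi walk z - z) <= (expR 1 + 1) / N%:R * rnorm x.
Proof.
move=> zE; rewrite (etrans zE (rep_walk_meanE x)) {zE}.
have := rnorm_walk_iter_le x (leqnn N).
move: (rep_alg pi walk) => T TN.
have -> : T (N%:R^-1 *: \sum_(0 <= j < N) iter j T x) -
    N%:R^-1 *: \sum_(0 <= j < N) iter j T x = N%:R^-1 *: (iter N T x - x).
  rewrite bop_scale -scalerBr; congr (_ *: _).
  rewrite (big_morph T (bop_add T) (bop0 T)) -sumrB.
  exact: (telescope_sumr (fun j => iter j T x)).
rewrite rnormZ rnorm_invN [_ / _]mulrC -mulrA ler_wpM2l ?invr_ge0 //.
apply: le_trans (rnormD _ _) _; rewrite rnormN mulrDl mul1r lerD2r.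
exact: TN.
Qed.

End Rep.

End WalkMeans.

(** * A contracting mean *)

Section Contraction.
Context {R : realType} {G : groupType} (S : generating_set G) (L : seq G).
Hypothesis SL : S = [set` L] :> set G.
Implicit Types E : completeNormedModType R[i].

(** Each correction halves the displacement, so successive corrections decay geometrically, with sum
    at most [2 * C * disp L pi x], and the limit has displacement 0. *)
Lemma exact_invariant (C : R) E (pi : representation G E) :
  0 < C -> growth S 1 pi ->
  (forall x, exists y, rnorm y <= C * disp L pi x /\
     disp L pi (x - y) <= disp L pi x / 2) ->
  forall x, exists y, rnorm y <= 2 * C * disp L pi x /\ invariants pi (x - y).
Proof.
move=> C0 pi1 /choice [cor hcor] x.
have [x0|x0] := eqVneq (disp L pi x) 0.
  exists 0; rewrite rnorm0 x0 mulr0 subr0; split=> //.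
  exact/(disp_eq0 SL).
have xgt0 : 0 < disp L pi x by rewrite lt_neqAle eq_sym x0 disp_ge0.
pose D := C * disp L pi x; have D0 : 0 < D by rewrite mulr_gt0.
pose step y := y - cor y; pose u k := iter k step x.
have du k : disp L pi (u k) <= disp L pi x * 2^-1 ^+ k.
  elim: k => [|k IH]; first by rewrite expr0 mulr1.
  apply: le_trans (hcor (u k)).2 _.
  by rewrite exprSr mulrA ler_wpM2r ?invr_ge0.
(* Dividing by [D] gives steps of size at most [2^-1 ^+ k], the form [fast_cauchy] requires. *)
pose v k := D^-1%:C%C *: u k.
have dv k : rnorm (v k.+1 - v k) <= 2^-1 ^+ k.
  rewrite /v -scalerBr /u iterS -/(u k) {1}/step addrC addKr scalerN rnormN.
  rewrite rnormZ rnormR gtr0_norm ?invr_gt0 // ler_pdivrMl //.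
  apply: le_trans (hcor (u k)).1 _.
  by rewrite /D -mulrA ler_pM2l.
have [l hl] := banach_complete (fast_cauchy (p := rnorm_seminorm E) dv).
have {}hl := fast_lim (p := rnorm_seminorm E) dv hl.
have [B B0 hB] := @disp_bound R G S L.
have l0 : disp L pi l = 0.
  apply/eqP; rewrite eq_le disp_ge0 andbT; apply/ler_addgt0Pr => e e0.
  pose K := D^-1 * disp L pi x + 2 * B.
  have K0 : 0 < K by rewrite addr_gt0 ?mulr_gt0 ?invr_gt0.
  have [k hk] := half_small (divr_gt0 e0 K0); have {hk} := hk k (leqnn k).
  rewrite add0r ler_pdivlMr // mulrC => /(le_trans _); apply.
  have -> : l = v k - (v k - l) by rewrite opprB addrC subrK.
  apply: le_trans (dispD _ _ _ _) _; rewrite dispN mulrDl; apply: lerD.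
    by rewrite dispZ rnormR gtr0_norm ?invr_gt0 // -mulrA ler_pM2l ?invr_gt0.
  apply: le_trans (hB _ _ pi1 _) _.
  by rewrite [2 * B]mulrC -mulrA ler_pM2l //; exact: hl.
exists (x - D%:C%C *: l); split.
  have := hl 0%N; rewrite /= expr0 mulr1 /v /u /= => h.
  have -> : x - D%:C%C *: l = D%:C%C *: (D^-1%:C%C *: x - l).
    by rewrite scalerBr scalerA -rmorphM mulfV ?gt_eqF // scale1r.
  by rewrite rnormZ rnormR gtr0_norm // -mulrA -/D mulrC ler_pM2r.
rewrite opprB addrC subrK.
by apply/(disp_eq0 SL); rewrite dispZ l0 mulr0.
Qed.


Section FixedPoint.
Variable cE : completeNormedModType R[i] -> Prop.
Hypothesis cE_superreflexive : forall X, cE X -> superreflexive X.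
Hypothesis cE_ultraproducts : stable_by_ultraproducts cE.
Hypothesis G_FE : fixed_point_property G cE.

Lemma walk_mean_contraction : exists n N, (0 < N)%N /\
  forall E, cE E -> forall pi : representation G E, growth S n.+1%:R^-1 pi ->
  forall x, disp L pi (rep_alg pi (walk_mean L N) x) <= disp L pi x / 2.
Proof.
have [n hn] := approx_invariant SL cE_ultraproducts G_FE.
have growth1 k E (pi : representation G E) : growth S k.+1%:R^-1 pi -> growth S 1 pi.
  by apply: growth_le; rewrite invf_le1 ?ler1n.
have hinv E (EE : cE E) (pi : representation G E) (pin : growth S n.+1%:R^-1 pi) :=
  exact_invariant (ltr0Sn R n) (growth1 _ _ _ pin) (hn E EE pi pin).
pose C : R := 2 * n.+1%:R; have C0 : 0 <= C by rewrite mulr_ge0.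
apply: contrapT => no.
have /choice [P hP] k : exists P : @pointed_rep R G,
    [/\ cE (pr_space P), growth S (n + k).+1%:R^-1 (pr_rep P),
        rnorm (pr_vec P) <= C &
        2^-1 < disp L (pr_rep P)
          (rep_alg (pr_rep P) (walk_mean L k.+1) (pr_vec P))].
  (* The rate [(n + k).+1^-1] is at most [n.+1^-1], as [hinv] requires, and at most [k.+1^-1], so
     that rate times [N = k.+1] stays below 1. *)
  apply: contrapT => noP; apply: no; exists (n + k)%N, k.+1.
  split=> // E EE pi pink x; rewrite leNgt; apply/negP => hx; apply: noP.
  have pin : growth S n.+1%:R^-1 pi.
    apply: growth_le pink; rewrite lef_pV2 ?posrE ?ltr0n //.
    by rewrite ler_nat ltnS leq_addr.
  have [y [yC xy]] := hinv E EE pi pin x; rewrite -/C in yC.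
  have a1 := @augmentation_walk_mean R G S L SL _ (ltn0Sn k).
  move: hx; move: (walk_mean _ _) a1 => m a1.
  (* As [m] has mass 1 it fixes the invariant vector [x - y], so [x] may be replaced by [y], whose
     norm is controlled by the displacement of [x]. *)
  have -> : disp L pi (rep_alg pi m x) = disp L pi (rep_alg pi m y).
    rewrite -(disp_invariant L (rep_alg pi m x) xy).
    have := rep_alg_invariants m xy; rewrite a1 scale1r bop_sub => E1.
    by rewrite -E1 opprB addrC subrK.
  have [x0|x0] := eqVneq (disp L pi x) 0.
    have y0 : y = 0.
      apply/rnorm0_eq0/eqP; rewrite eq_le rnorm_ge0 andbT.
      by rewrite x0 mulr0 in yC.
    by rewrite y0 bop0 disp0 x0 mul0r ltxx.
  have xgt0 : 0 < disp L pi x by rewrite lt_neqAle eq_sym x0 disp_ge0.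
  move=> hx; exists (PointedRep pi ((disp L pi x)^-1%:C%C *: y)); split=> //=.
    by rewrite rnormZ rnormR gtr0_norm ?invr_gt0 // mulrC ler_pdivrMr.
  rewrite bop_scale dispZ rnormR gtr0_norm ?invr_gt0 //.
  by rewrite mulrC ltr_pdivlMr // mulrC.
have [U [UU NU]] := @ultraFilterLemma nat \oo _.
pose E k := pr_space (P k); pose pi k : representation G (E k) := pr_rep (P k).
pose y k : E k := pr_vec (P k).
have hcE k : cE (E k) by have [] := hP k.
have piP k g : rnorm (pi k g) <= expR (k.+1%:R^-1 * (word_length S g)%:R).
  have [_ h _ _] := hP k; apply: (growth_le _ h).
  by rewrite lef_pV2 ?posrE ?ltr0n // ler_nat ltnS leq_addl.
have ck k : 0 <= k.+1%:R^-1 :> R by rewrite invr_ge0.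
have ck1 k : k.+1%:R^-1 * k.+1%:R <= 1 :> R by rewrite mulVf.
have zP : exists M, forall k, rnorm (rep_alg (pi k) (walk_mean L k.+1) (y k)) <= M.
  exists (expR 1 * C) => k.
  apply: le_trans (rnorm_walk_mean SL (piP k) (ck k) (ltn0Sn k) (ck1 k) (y k)) _.
  by have [_ _ h _] := hP k; rewrite ler_wpM2l ?expR_ge0.
pose z := BoundedFamily zP.
have [Y [EY XY]] := cE_ultraproducts UU hcE.
have Xr := reflexive_isometric (cE_superreflexive EY) XY.
have l0 : forall g, 0 <= (word_length S g)%:R :> R by move=> g; exact: ler0n.
pose Pi := urep (UU := UU) NU l0 piP.
have walk_z k : rnorm (rep_alg (pi k) (walk L) (z k) - z k) <=
    (expR 1 + 1) * C / k.+1%:R.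
  have := walk_mean_almost_harmonic SL (piP k) (ck k) (ck1 k)
    (erefl (rep_alg (pi k) (walk_mean L k.+1) (y k))).
  move=> /le_trans; apply.
  have [_ _ h _] := hP k; rewrite mulrAC ler_wpM2r ?invr_ge0 //.
  by rewrite ler_wpM2l // addr_ge0 ?expR_ge0.
have sL0 : (size L)%:R != 0 :> R[i].
  by rewrite pnatr_eq0 -lt0n (generators_nonempty SL).
have zh : \sum_(s <- L) Pi s (uclass z) = (size L)%:R *: uclass z.
  (* The average over the generators is taken on families: its coordinates are the walk applied to
     [z k], and its class is the average of the [Pi s (uclass z)]. *)
  pose Tz : bounded_family E := (size L)%:R^-1 *: \sum_(s <- L) fam_act l0 piP s z.
  have uTz : uclass (UU := UU) Tz = (size L)%:R^-1 *: \sum_(s <- L) Pi s (uclass z).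
    rewrite uclassZ (big_morph uclass (uclassD (E := E)) uclass0).
    by congr (_ *: _); apply: eq_bigr => s _; rewrite [RHS]urepE.
  suff Tzz : uclass (UU := UU) Tz = uclass z.
    by rewrite -[in RHS]Tzz uTz scalerA mulfV // scale1r.
  apply/uclass_eq => e e0; apply: (NU).
  pose q : R := (expR 1 + 1) * C / e.
  exists (Num.truncn q) => // k hk; suff : rnorm (Tz k - z k) <= e by [].
  have TzE : rep_alg (pi k) (walk L) (z k) = Tz k.
    rewrite rep_walkE; congr (_ *: _); apply: esym.
    exact: (big_morph (fun v : bounded_family E => v k)).
  apply: le_trans (_ : (expR 1 + 1) * C / k.+1%:R <= _).
    by case: _ / TzE; exact: walk_z.
  rewrite ler_pdivrMr // [e * _]mulrC -ler_pdivrMr // -/q.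
  by apply: le_trans (ltW (truncnS_gt _)) _; rewrite ler_nat.
have [w hw] := generated_countable SL.
have zinv := orbit_harmonic_invariant Xr hw (urep_isometric NU l0 piP) zh.
have hz : U [set k | disp L (pi k) (z k) <= 2^-1].
  apply: disp_eventually_le => [s e sL e0|]; last by rewrite invr_gt0.
  by have := zinv s sL; rewrite urepE => /uclass_eq /(_ e e0).
have [k hk] := filter_ex hz.
by have [_ _ _] := hP k; rewrite ltNge => /negP; apply.
Qed.

End FixedPoint.
End Contraction.

(** * The Kazhdan projection *)

Section Conjugate.
Context {R : realType} {G : groupType} {X Y : completeNormedModType R[i]}.
Context (f : boundedOp X Y) (h : boundedOp Y X) (pi : representation G X).
Hypotheses (fh : cancel f h) (hf : cancel h f).

Fact conj_rep1 : compop f (compop (pi 1%g) h) = idop Y.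
Proof. by apply: bop_ext => y; rewrite !compopE rep1 hf. Qed.

Fact conj_repM g k : compop f (compop (pi (g * k)%g) h) =
  compop (compop f (compop (pi g) h)) (compop f (compop (pi k) h)).
Proof. by apply: bop_ext => y; rewrite !compopE repM fh. Qed.

(** The collection contains spaces merely isometric to members of [cE]; conjugation moves their
    representations onto the members. *)
Definition conj_rep : representation G Y :=
  Representation (rep_op := fun g => compop f (compop (pi g) h))
    conj_rep1 conj_repM.

Lemma conj_repE g x : conj_rep g (f x) = f (pi g x).
Proof. by rewrite !compopE fh. Qed.

Lemma rep_alg_conj a x : rep_alg conj_rep a (f x) = f (rep_alg pi a x).
Proof.
rewrite !rep_alg_sumE (big_morph f (bop_add f) (bop0 f)).
by apply: eq_bigr => g _; rewrite conj_repE bop_scale.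
Qed.

Lemma disp_conj (L : seq G) x : (forall z, rnorm (f z) = rnorm z) ->
  disp L conj_rep (f x) = disp L pi x.
Proof.
by move=> fN; apply: eq_bigr => s _; rewrite conj_repE -bop_sub fN.
Qed.

End Conjugate.

(** * The projection as a limit of powers *)

Section KazhdanProjection.
Context {R : realType} {G : groupType} (S : generating_set G) (L : seq G).
Hypothesis SL : S = [set` L] :> set G.
Variables (cE : completeNormedModType R[i] -> Prop) (c : R).
Hypothesis c1 : c <= 1.
Local Notation F := (small_growth_collection cE S c).
Local Notation A := (group_algebra R G).
Variable m : A.
Hypothesis m1 : augmentation m = 1.
Hypothesis m_contraction : forall E (pi : representation G E), F E pi ->
  forall x, disp L pi (rep_alg pi m x) <= disp L pi x / 2.

Let growthF E (pi : representation G E) : F E pi -> growth S 1 pi.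
Proof. by move=> [_]; exact: growth_le. Qed.

Lemma disp_rep_algX E (pi : representation G E) : F E pi -> forall k x,
  disp L pi (rep_alg pi (m ^+ k) x) <= 2^-1 ^+ k * disp L pi x.
Proof.
move=> Fpi k x; rewrite rep_algX; elim: k => [|k IH]; first by rewrite expr0 mul1r.
rewrite iterS exprSr mulrAC; apply: le_trans (m_contraction Fpi _) _.
by rewrite ler_wpM2r ?invr_ge0.
Qed.

(** Mass 1 turns [m x - x] into a combination of the coboundaries [pi g x - x]. *)
Lemma rep_alg_disp_bound : exists2 K : R, 0 <= K &
  forall E (pi : representation G E), growth S 1 pi ->
  forall x, rnorm (rep_alg pi m x - x) <= K * disp L pi x.
Proof.
have /choice [K hK] g : exists K : R, 0 <= K /\
  forall E (pi : representation G E), growth S 1 pi ->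
  forall x, rnorm (pi g x - x) <= K * disp L pi x.
  by have [K K0 hK] := @rep_disp_bound R G S L SL g; exists K.
exists (\sum_(g <- msupp m) rnorm m@_g * K g).
  by apply: sumr_ge0 => g _; rewrite mulr_ge0 ?rnorm_ge0 //; have [] := hK g.
move=> E pi pi1 x.
have -> : rep_alg pi m x - x = \sum_(g <- msupp m) m@_g *: (pi g x - x).
  rewrite rep_alg_sumE -[in X in _ - X](scale1r x) -m1 scaler_suml -sumrB.
  by apply: eq_bigr => g _; rewrite scalerBr.
rewrite mulr_suml.
apply: (big_ind2 (fun (y : E) r => rnorm y <= r)) => [|y r y' r' h h'|g _].
- by rewrite rnorm0.
- by apply: le_trans (rnormD _ _) _; exact: lerD.
- rewrite rnormZ -mulrA ler_wpM2l ?rnorm_ge0 //.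
  by have [_] := hK g; apply.
Qed.

(** Consecutive powers differ at [x] by at most [K] times the displacement of a power applied to
    [x], which decays like [2^-1 ^+ k]; the shift [k0] absorbs the constant [K * B]. *)
Lemma coll_norm_powers : exists k0, forall k,
  coll_seminorm F (m ^+ (k0 + k.+1) - m ^+ (k0 + k)) <= 2^-1 ^+ k.
Proof.
have [K K0 hK] := rep_alg_disp_bound; have [B B0 hB] := @disp_bound R G S L.
have KB0 : 0 < K * B + 1 by rewrite ltr_wpDl // mulr_ge0 // ltW.
have [k0 hk0] : exists N, forall n, (N <= n)%N -> (2^-1 : R) ^+ n <= (K * B + 1)^-1.
  by apply: half_small; rewrite invr_gt0.
exists k0 => k; apply: coll_norm_le => [|E pi Fpi].
  by rewrite exprn_ge0 // invr_ge0.
rewrite rnorm_opE; apply: opnorm_le => [|x]; first by rewrite exprn_ge0 // invr_ge0.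
have pi1 := growthF Fpi.
have -> : rep_alg pi (m ^+ (k0 + k.+1) - m ^+ (k0 + k)) x =
    rep_alg pi m (rep_alg pi (m ^+ (k0 + k)) x) - rep_alg pi (m ^+ (k0 + k)) x.
  by rewrite rep_algB bopB addnS exprS rep_algM compopE.
apply: le_trans (hK _ _ pi1 _) _.
apply: le_trans (ler_wpM2l K0 (disp_rep_algX Fpi _ _)) _.
have h1 := hB _ _ pi1 x; have x0 := rnorm_ge0 x.
have h2 := hk0 k0 (leqnn _); have h3 := Defs.half_gt0 R k.
have h4 : K * disp L pi x <= K * B * rnorm x by rewrite -mulrA ler_wpM2l.
have -> : K * (2^-1 ^+ (k0 + k) * disp L pi x) =
    2^-1 ^+ k * (2^-1 ^+ k0 * (K * disp L pi x)) by rewrite exprD; ring.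
rewrite ler_pM2l //; apply: le_trans (ler_pM _ _ h2 h4) _.
- by rewrite exprn_ge0 // invr_ge0.
- by rewrite mulr_ge0 // disp_ge0.
- by rewrite ler_pdivrMl // ler_wpM2r // lerDl.
Qed.

Lemma contraction_kazhdan_projection :
  exists p : coll_completion F, kazhdan_projection p.
Proof.
have [k0 hk0] := coll_norm_powers; pose u k := m ^+ (k0 + k).
have du k : coll_seminorm F (u k.+1 - u k) <= 2^-1 ^+ k := hk0 k.
pose x : cauchy_seq (coll_seminorm F) := CauchySeq (fast_cauchy du).
pose p : coll_completion F := completion_of_seq x.
have up : to_completion (coll_seminorm F) (u n) @[n --> \oo] --> p.
  apply/sn_cvgP => e /(csP x) [N hN]; exists N => n Nn.
  rewrite /= -[X in rnorm X]sepquot_piB [X in X <= _]sepquot_rnormE.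
  by apply: (@cs_norm_le _ _ _ _ _ N) => k Nk /=; exact: hN.
exists p; split.
- apply: etrans (Defs.pi_mul x x) _; apply/pi_eqP/eqP; rewrite eq_le cs_norm_ge0 andbT.
  apply/ler_addgt0Pr => e /(csP x) [N hN]; rewrite add0r.
  apply: (@cs_norm_le _ _ _ _ _ N) => n Nn /=.
  (* The square of a term is a later term of the same Cauchy sequence. *)
  have -> : u n * u n = u (n + (k0 + n))%N by rewrite /u -exprD -addnA.
  by apply: hN => //; rewrite (leq_trans Nn) // leq_addr.
- move=> B /up [N _ hN]; exists (to_completion (coll_seminorm F) (u N)); split.
    by exists (u N) => //; exact: augmentationX.
  by apply: hN => /=.
move=> E pi Fpi; set T := rep_ext pi p; have pi1 := growthF Fpi.
(* [rep_ext] is computed along the chosen representative of [p]; its difference from [u] tends to 0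
   in the collection norm, so [u] has the same limit. *)
have uT e : 0 < e -> exists N, forall n, (N <= n)%N -> opnorm (rep_alg pi (u n) - T) <= e.
  move=> e0; have e20 : 0 < e / 2 by apply: divr_gt0.
  have /sn_cvgP /(_ _ e20) [N1 h1] := @rep_ext_cvg _ _ F _ _ p Fpi.
  have : cs_norm (x - completion_seq p) < e / 2.
    rewrite (_ : cs_norm _ = 0) //; apply/pi_eqP.
    by rewrite completion_seqK.
  move=> /cs_norm_lt [N2 h2]; exists (maxn N1 N2) => n; rewrite geq_max => /andP[n1 n2].
  have -> : rep_alg pi (u n) - T = rep_alg pi (u n - completion_seq p n) +
      (rep_alg pi (completion_seq p n) - T).
    by rewrite rep_algB addrA subrK.
  rewrite -rnorm_opE; apply: le_trans (rnormD _ _) _.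
  have := h1 n n1; have := h2 n n2.
  have := @coll_norm_ge _ _ F _ _ (u n - completion_seq p n) Fpi.
  rewrite /=; lra.
(* [T y] is a limit of vectors whose displacements tend to 0. *)
have Tinv y : invariants pi (T y).
  have [B B0 hB] := @disp_bound R G S L.
  apply/(disp_eq0 SL)/eqP; rewrite eq_le disp_ge0 andbT.
  apply/ler_addgt0Pr => e e0; rewrite add0r.
  have y0 := rnorm_ge0 y; have dy0 := disp_ge0 L pi y.
  have d0 : 0 < e / (disp L pi y + B * rnorm y + 1).
    by rewrite divr_gt0 // ltr_wpDl // addr_ge0 // mulr_ge0 // ltW.
  have [N1 h1] := half_small d0; have [N2 h2] := uT _ d0.
  pose n := maxn N1 N2.
  have {}h1 := h1 (k0 + n)%N (leq_trans (leq_maxl _ _) (leq_addl _ _)).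
  have {}h2 := h2 n (leq_maxr _ _).
  have -> : T y = rep_alg pi (u n) y - (rep_alg pi (u n) - T) y.
    by rewrite bopB opprB addrC subrK.
  apply: le_trans (dispD _ _ _ _) _; rewrite dispN.
  have a1 := disp_rep_algX Fpi (k0 + n) y.
  have a2 := hB _ _ pi1 ((rep_alg pi (u n) - T) y).
  have a3 := opnormP (rep_alg pi (u n) - T) y.
  have a4 := ler_wpM2r dy0 h1; have a5 := ler_wpM2r y0 h2.
  have a6 := ler_wpM2l (ltW B0) (le_trans a3 a5).
  have dE : e / (disp L pi y + B * rnorm y + 1) * (disp L pi y + B * rnorm y + 1) = e.
    by rewrite mulfVK // gt_eqF // ltr_wpDl // addr_ge0 // mulr_ge0 // ltW.
  move: a4 a6 dE; set d := e / _ in d0 *; move=> a4 a6 dE.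
  rewrite !mulrDr mulr1 in dE; rewrite mulrCA in a6.
  rewrite -/(u n) in a1; lra.
(* All powers of [m] have mass 1, hence fix [y]. *)
have Tfix y : invariants pi y -> T y = y.
  move=> hy; apply/eqP; rewrite eq_sym -subr_eq0; apply/eqP/rnorm0_eq0/eqP.
  rewrite eq_le rnorm_ge0 andbT; apply/ler_addgt0Pr => e e0; rewrite add0r.
  have y0 := rnorm_ge0 y; have d0 : 0 < e / (rnorm y + 1).
    by rewrite divr_gt0 // ltr_wpDl.
  have [N hN] := uT _ d0; have {}hN := hN N (leqnn _).
  have := opnormP (rep_alg pi (u N) - T) y.
  rewrite bopB rep_alg_invariants // augmentationX // scale1r.
  move=> /le_trans; apply; apply: le_trans (ler_wpM2r y0 hN) _.
  by rewrite mulrAC ler_pdivrMr ?ltr_wpDl // ler_pM2l // lerDl.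
split; first by apply: bop_ext => y; rewrite compopE Tfix.
apply/seteqP; split=> [_ [y _ <-]//|y hy].
by exists y => //; exact: Tfix.
Qed.

End KazhdanProjection.

Theorem corollary5p11 (R : realType)
  (cE : completeNormedModType R[i] -> Prop)
  (cE_superreflexive : forall X, cE X -> superreflexive X)
  (cE_ultraproducts : stable_by_ultraproducts cE)
  (G : groupType) (S : generating_set G)
  (G_FE : fixed_point_property G cE) :
  robust_property_T cE S.
Proof.
have [L SL] := (finite_seqP _).1 (gs_finite S).
have [n [N [N0 hN]]] :=
  walk_mean_contraction SL cE_superreflexive cE_ultraproducts G_FE.
have aN := @augmentation_walk_mean R G S L SL N N0.
exists n.+1%:R^-1; first by rewrite invr_gt0.
apply: (contraction_kazhdan_projection SL _ aN) => [|E pi].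
  by rewrite invf_le1 ?ler1n.
move=> [[E0 [EE0 /isometric_ops [f [h [fh hf fN hN']]]]] pin] x.
have := hN E0 EE0 (conj_rep pi fh hf) _ (f x).
rewrite rep_alg_conj !disp_conj //; apply=> g.
rewrite rnorm_opE; apply: opnorm_le => [|y]; first exact: expR_ge0.
by rewrite !compopE fN -(hN' y); exact: growthP.
Qed.
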